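(* Let $R$ be a commutative Noetherian ring, $\alpha$ an automorphism of $R$ and $S=R[\theta;\alpha]$. Let $V$ be a simple right $S$-module with annihilator $Q=\mathrm{Ann}_S(V)$. If $(Q\cap R)S\subsetneq Q$, then $S/Q$ is Artinian and every finitely generated essential extension of $V$ is Artinian.
   Context: $R[\theta;\alpha]$ denotes the skew polynomial ring of polynomials $\sum r_i\theta^i$ ($r_i\in R$) with multiplication determined by $\theta r=\alpha(r)\theta$ for $r\in R$. Modules are right modules. *)

(* Defs.v *)
From HB Require Import structures.
From mathcomp Require Import all_boot all_order all_algebra.
Set Implicit Arguments. Unset Strict Implicit. Unset Printing Implicit Defensive.
Import Order.TTheory GRing.Theory Num.Theory.
Local Open Scope ring_scope.

(* Skew polynomial ring S = R[theta; a]: elements are represented by their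
   coefficient polynomials sum r_i theta^i, with multiplication
   (a_i theta^i)(b_j theta^j) = a_i a^i(b_j) theta^(i+j). *)
Definition skew_mul (R : comNzRingType) (a : R -> R) (p q : {poly R}) : {poly R} :=
  \poly_(k < (size p + size q).-1) \sum_(i < k.+1) p`_i * iter i a q`_(k - i).

Definition is_right_module (R : comNzRingType) (a : R -> R) (V : zmodType)
  (act : V -> {poly R} -> V) : Prop :=
  [/\ (forall v, act v 1 = v),
      (forall v w s, act (v + w) s = act v s + act w s),
      (forall v s t, act v (s + t) = act v s + act v t) &
      (forall v s t, act (act v s) t = act v (skew_mul a s t))].

Definition is_submodule (R : comNzRingType) (V : zmodType)
  (act : V -> {poly R} -> V) (N : V -> Prop) : Prop :=
  [/\ N 0, (forall x y, N x -> N y -> N (x + y)) &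
      (forall x s, N x -> N (act x s))].

Definition simple_module (R : comNzRingType) (V : zmodType)
  (act : V -> {poly R} -> V) : Prop :=
  (exists v : V, v <> 0) /\
  forall N, is_submodule act N -> (forall x, N x -> x = 0) \/ (forall x, N x).

Definition ann (R : comNzRingType) (V : zmodType) (act : V -> {poly R} -> V)
  : {poly R} -> Prop := fun s => forall v, act v s = 0.

Definition is_ideal (R : comNzRingType) (I : R -> Prop) : Prop :=
  [/\ I 0, (forall x y, I x -> I y -> I (x + y)) & (forall r x, I x -> I (r * x))].

Definition noetherian_ring (R : comNzRingType) : Prop :=
  forall I : nat -> R -> Prop, (forall n, is_ideal (I n)) ->
    (forall n x, I n x -> I n.+1 x) ->
    exists n, forall m x, (n <= m)%N -> I m x -> I n x.

Definition is_right_ideal (R : comNzRingType) (a : R -> R) (I : {poly R} -> Prop) :=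
  [/\ I 0, (forall x y, I x -> I y -> I (x + y)) &
      (forall p s, I p -> I (skew_mul a p s))].

Definition is_left_ideal (R : comNzRingType) (a : R -> R) (I : {poly R} -> Prop) :=
  [/\ I 0, (forall x y, I x -> I y -> I (x + y)) &
      (forall p s, I p -> I (skew_mul a s p))].

(* S/Q right Artinian: DCC on right ideals of S/Q, i.e. right ideals of S containing Q *)
Definition quotient_right_artinian (R : comNzRingType) (a : R -> R) (Q : {poly R} -> Prop) :=
  forall I : nat -> {poly R} -> Prop, (forall n, is_right_ideal a (I n)) ->
    (forall n p, Q p -> I n p) -> (forall n p, I n.+1 p -> I n p) ->
    exists n, forall m p, (n <= m)%N -> I n p -> I m p.

Definition quotient_left_artinian (R : comNzRingType) (a : R -> R) (Q : {poly R} -> Prop) :=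
  forall I : nat -> {poly R} -> Prop, (forall n, is_left_ideal a (I n)) ->
    (forall n p, Q p -> I n p) -> (forall n p, I n.+1 p -> I n p) ->
    exists n, forall m p, (n <= m)%N -> I n p -> I m p.

Definition artinian_module (R : comNzRingType) (M : zmodType)
  (act : M -> {poly R} -> M) : Prop :=
  forall N : nat -> M -> Prop, (forall n, is_submodule act (N n)) ->
    (forall n x, N n.+1 x -> N n x) ->
    exists n, forall m x, (n <= m)%N -> N n x -> N m x.

Definition fin_gen (R : comNzRingType) (M : zmodType) (act : M -> {poly R} -> M) : Prop :=
  exists gs : seq M, forall m : M, exists ss : seq {poly R},
    m = \sum_(i < size gs) act gs`_i ss`_i.

Definition ext_ideal (R : comNzRingType) (a : R -> R) (J : R -> Prop) : {poly R} -> Prop :=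
  fun p => exists l : seq (R * {poly R}),
    (forall x, x \in l -> J x.1) /\ p = \sum_(x <- l) skew_mul a x.1%:P x.2.

(* Main.v *)
Require Import Defs.
From Stdlib Require Import Classical IndefiniteDescription.
From HB Require Import structures.
From mathcomp Require Import all_boot all_order all_algebra.
Import GRing.Theory.
Local Open Scope ring_scope.
Set Implicit Arguments. Unset Strict Implicit. Unset Printing Implicit Defensive.

(** Let [P] be the intersection of [Q] with [R]. As [theta] is normal, it acts on [V] as [0]
    or bijectively.

    If [V theta = 0], then [S/Q = R/P] is a field. On an essential extension [M], Fitting's
    lemma makes [theta] nilpotent, and then every element of [P] nilpotent on [ker theta],
    so [M] has finite length over [R].

    If [theta] is bijective on [V], then [P] is stable under [alpha] and prime with respect to
    stable ideals. Comparing [alpha^n(b) q] with [q b] for [q] in [Q] of minimal degree [n]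
    modulo [P] shows that [alpha] has finite order on [R/P] and yields
    [z = c theta^n + ...] in [Q], normal modulo [P], with [c] outside [P] invariant modulo [P].
    After inverting [c], [V] is finitely generated over [R/P], hence [R/P] is a finite product
    of fields and [S/Q] is a finite module over it; separating [S/Q] by finitely many
    vectors of [V] shows that [c] is already invertible in [S/Q], which is thus Artinian.

    For an essential extension [M], Artin-Rees for [P] gives [M P^k = 0]. On [ann_M P] Fitting's
    lemma makes [z] nilpotent, and [ann_M P cap ker z] is killed by [Q]. The layer
    [ann_M P^(i+1) / ann_M P^i] embeds [R]-linearly into finitely many copies of the previous
    one; since [R] is commutative, [c] acts surjectively from the left on the bimodule of such
    maps, and the ascending chain condition on left ideals turns this into an inverse
    of [c] in the image of [S]. So [S]-submodules of a layer are submodules over the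
    localisation of [R] at [c], where lengths are finite. *)

(** * Choice, well-ordering and monotone chains *)

Lemma exists_maximal (X : Type) (lt : X -> X -> Prop) (F : X -> Prop) :
  (forall f : nat -> X, (forall n, F (f n)) -> exists n, ~ lt (f n) (f n.+1)) ->
  forall x0, F x0 -> exists x, F x /\ forall y, F y -> ~ lt x y.
Proof.
move=> acc x0 Fx0; apply: NNPP => nomax.
have next (x : {x | F x}) : exists y : {y | F y}, lt (sval x) (sval y).
  apply: NNPP => H; apply: nomax; exists (sval x); split; first exact: svalP.
  by move=> y Fy xy; apply: H; exists (exist _ y Fy).
(* Without a maximal element, choice iterates a strict enlargement and yields a sequence forbidden
   by the chain hypothesis. *)
pose g x := sval (constructive_indefinite_description _ (next x)).
pose f n := iter n g (exist _ x0 Fx0).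
have [n] := acc (fun n => sval (f n)) (fun n => svalP (f n)); apply.
exact: (svalP (constructive_indefinite_description _ (next (f n)))).
Qed.

Lemma exists_least (F : nat -> Prop) :
  (exists n, F n) -> exists n, F n /\ forall m, (m < n)%N -> ~ F m.
Proof.
case=> n; elim/ltn_ind: n => n IH Fn.
case: (classic (exists m, (m < n)%N /\ F m)) => [[m [lt_mn Fm]]|H].
  exact: IH lt_mn Fm.
by exists n; split=> // m lt_mn Fm; apply: H; exists m.
Qed.

Lemma uniform_stage (F : nat -> nat -> Prop) k :
  (forall i n m, (n <= m)%N -> F i n -> F i m) ->
  (forall i, exists n, F i n) -> exists n, forall i, (i < k)%N -> F i n.
Proof.
move=> mono ex; elim: k => [|k [n IH]]; first by exists 0%N.
have [n' Fn'] := ex k; exists (maxn n n') => i; rewrite ltnS leq_eqVlt.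
case/orP=> [/eqP->|/IH]; first exact: mono (leq_maxr _ _) Fn'.
exact: mono (leq_maxl _ _).
Qed.

Lemma chain_incr (T : Type) (N : nat -> T -> Prop) :
  (forall n x, N n x -> N n.+1 x) ->
  forall m n x, (m <= n)%N -> N m x -> N n x.
Proof.
move=> mono m n x /subnKC <-; elim: (n - m)%N => [|k IH]; first by rewrite addn0.
by move=> H; rewrite addnS; apply/mono/IH.
Qed.

Lemma chain_decr (T : Type) (N : nat -> T -> Prop) :
  (forall n x, N n.+1 x -> N n x) ->
  forall m n x, (m <= n)%N -> N n x -> N m x.
Proof.
move=> mono m n x /subnKC <-; elim: (n - m)%N => [|k IH]; first by rewrite addn0.
by rewrite addnS => /mono.
Qed.

(** * A graded Hilbert basis theorem *)

Section GradedHilbert.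

Variable M : zmodType.
Implicit Types (Om : (M -> M) -> nat -> Prop) (N D : nat -> M -> Prop) (T : M -> M).

(* [Om o d] says that [o] is an allowed operator, homogeneous of degree [d];
   a graded subgroup of the graded group with all components [M] is a family of
   subsets of [M]. *)
Definition gclosed Om N : Prop :=
  [/\ (forall i, N i 0), (forall i x y, N i x -> N i y -> N i (x - y)) &
      (forall o d, Om o d -> forall i x, N i x -> N (i + d)%N (o x))].

(** Stationarity is required only on elements of [D], so that [D] need not become a type of its
    own. *)
Definition gacc Om D : Prop :=
  forall N : nat -> nat -> M -> Prop, (forall n, gclosed Om (N n)) ->
    (forall n i x, N n i x -> N n.+1 i x) ->
    exists n, forall m i x, (n <= m)%N -> D i x -> N m i x -> N n i x.

Definition addop Om T t : (M -> M) -> nat -> Prop :=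
  fun o d => Om o d \/ o = T /\ d = t.

(* The component of degree [i] need not meet [T^n D], hence the disjunction. *)
Definition top_layer D T (t n i : nat) (x : M) : Prop :=
  x = 0 \/ exists h d, [/\ D h d, (h + n * t)%N = i & x = iter n T d].

Fixpoint layer D T (t n i : nat) (x : M) : Prop :=
  if n is n'.+1 then
    exists y z, [/\ layer D T t n' i y, top_layer D T t n' i z & x = y + z]
  else x = 0.

Definition adjoin D T t i x : Prop := exists n, layer D T t n i x.

Variables (Om : (M -> M) -> nat -> Prop) (D : nat -> M -> Prop) (T : M -> M) (t : nat).
Hypothesis Dcl : gclosed Om D.
Hypothesis OmB : forall o d, Om o d -> forall x y, o (x - y) = o x - o y.
Hypothesis TB : forall x y, T (x - y) = T x - T y.
Hypothesis TOm : forall o d, Om o d -> exists o', Om o' d /\ forall x, T (o x) = o' (T x).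
Hypothesis OmT : forall o d, Om o d -> exists o', Om o' d /\ forall x, o (T x) = T (o' x).

Let T0 : T 0 = 0. Proof. by rewrite -(subrr 0) TB !subrr. Qed.

Let TD x y : T (x + y) = T x + T y.
Proof. by rewrite -{1}[y]opprK -(sub0r y) TB TB T0 sub0r opprK. Qed.

Let iterTB n x y : iter n T (x - y) = iter n T x - iter n T y.
Proof. by elim: n => //= n ->. Qed.

Let iterT0 n : iter n T 0 = 0.
Proof. by elim: n => //= n ->. Qed.

Let Om0 o d : Om o d -> o 0 = 0.
Proof. by move=> oO; rewrite -(subrr 0) (OmB oO) !subrr. Qed.

Let OmD o d : Om o d -> forall x y, o (x + y) = o x + o y.
Proof.
move=> oO x y; rewrite -{1}[y]opprK -(sub0r y) !(OmB oO) (Om0 oO).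
by rewrite sub0r opprK.
Qed.

Let iterT_Om n o d : Om o d -> exists o', Om o' d /\ forall x, iter n T (o x) = o' (iter n T x).
Proof.
move=> oO; elim: n => [|n [o1 [o1O E]]]; first by exists o.
have [o2 [o2O E2]] := TOm o1O; exists o2; split=> // x.
by rewrite !iterS E E2.
Qed.

Let Om_iterT n o d : Om o d -> exists o', Om o' d /\ forall x, o (iter n T x) = iter n T (o' x).
Proof.
move=> oO; elim: n => [|n [o1 [o1O E]]]; first by exists o.
have [o2 [o2O E2]] := OmT o1O; exists o2; split=> // x.
by rewrite !iterSr E E2.
Qed.

Let topB n i x y :
  top_layer D T t n i x -> top_layer D T t n i y -> top_layer D T t n i (x - y).
Proof.
have [D0 DB _] := Dcl.
case=> [->|[h1 [d1 [D1 E1 ->]]]] [->|[h2 [d2 [D2 E2 ->]]]].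
- by left; rewrite subr0.
- by right; exists h2, (0 - d2); split; rewrite ?iterTB ?iterT0 //; apply: DB.
- by right; exists h1, d1; split; rewrite ?subr0.
right; exists h1, (d1 - d2); split; rewrite ?iterTB //.
by apply: DB => //; move: E2; rewrite -E1 => /addIn <-.
Qed.

Let topOm n o d i x : Om o d -> top_layer D T t n i x -> top_layer D T t n (i + d) (o x).
Proof.
have [_ _ DO] := Dcl.
move=> oO; case=> [->|[h [e [De E ->]]]]; first by left; rewrite (Om0 oO).
have [o' [o'O Eo]] := Om_iterT n oO.
right; exists (h + d)%N, (o' e); split; [exact: DO| |exact: Eo].
by rewrite addnAC E.
Qed.

Let topT n i x : top_layer D T t n i x -> top_layer D T t n.+1 (i + t) (T x).
Proof.
case=> [->|[h [e [De E ->]]]]; first by left; rewrite T0.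
by right; exists h, e; split; rewrite // -E mulSn (addnC t) addnA.
Qed.

Let layer0 n i : layer D T t n i 0.
Proof. by elim: n => //= n IH; exists 0, 0; split; rewrite ?addr0 //; left. Qed.

Let layerB n i x y : layer D T t n i x -> layer D T t n i y -> layer D T t n i (x - y).
Proof.
elim: n x y => [|n IH] x y /=; first by move=> -> ->; rewrite subr0.
move=> [x1 [d1 [Lx Dx ->]]] [y1 [d2 [Ly Dy ->]]].
by exists (x1 - y1), (d1 - d2); split; [exact: IH|exact: topB|rewrite opprD addrACA].
Qed.

Let layerOm n o d i x : Om o d -> layer D T t n i x -> layer D T t n (i + d) (o x).
Proof.
move=> oO; elim: n x => [|n IH] x /=; first by move=> ->; rewrite (Om0 oO).
move=> [x1 [d1 [Lx Dx ->]]]; exists (o x1), (o d1).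
by split; [exact: IH|exact: topOm|rewrite (OmD oO)].
Qed.

Let layerT n i x : layer D T t n i x -> layer D T t n.+1 (i + t) (T x).
Proof.
elim: n x => [|n IH] x /=.
  by move=> ->; exists 0, 0; split; rewrite ?addr0 //; left.
move=> [x1 [d1 [Lx Dx ->]]]; exists (T x1), (T d1).
by split; [exact: IH|exact: topT|rewrite TD].
Qed.

Let layerS n i x : layer D T t n i x -> layer D T t n.+1 i x.
Proof. by move=> Lx; exists x, 0; split; rewrite ?addr0 //; left. Qed.

Let layerW m n i x : (m <= n)%N -> layer D T t m i x -> layer D T t n i x.
Proof.
exact: (@chain_incr _ (fun n x => layer D T t n i x) (fun n x => @layerS n i x)).
Qed.

Lemma adjoin_closed : gclosed (addop Om T t) (adjoin D T t).
Proof.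
split=> [i|i x y [n Lx] [m Ly]|o d [oO|[-> ->]] i x [n Lx]]; first by exists 0%N.
- by exists (maxn n m); apply: layerB; [apply: layerW Lx|apply: layerW Ly];
    rewrite ?leq_maxl ?leq_maxr.
- by exists n; apply: layerOm.
by exists n.+1; apply: layerT.
Qed.

Lemma adjoin_sub i x : D i x -> adjoin D T t i x.
Proof.
move=> Dx; exists 1%N, 0, x; rewrite add0r; split=> //.
by right; exists i, x; split=> //; rewrite mul0n addn0.
Qed.

(* The graded group of leading coefficients of [N] in degree [n] of [T]. *)
Let lead (N : nat -> M -> Prop) n h d :=
  D h d /\ exists y, layer D T t n (h + n * t) y /\ N (h + n * t)%N (y + iter n T d).

Let lead_closed N n : gclosed (addop Om T t) N -> gclosed Om (lead N n).
Proof.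
have [D0 DB DO] := Dcl.
move=> [N0 NB NO]; split=> [i|i x y [Dx [x1 [Lx Nx]]] [Dy [y1 [Ly Ny]]]|].
- by split=> //; exists 0; split=> //; rewrite iterT0 addr0.
- split; first exact: DB.
  exists (x1 - y1); split; first exact: layerB.
  by rewrite iterTB addrACA -opprD; apply: NB.
move=> o d oO i x [Dx [x1 [Lx Nx]]]; split; first exact: DO.
have [o' [o'O E]] := iterT_Om n oO; exists (o' x1); rewrite addnAC; split.
  exact: layerOm.
by rewrite E -(OmD o'O); apply: NO => //; left.
Qed.

(** Applying [T] to a witness raises its degree and keeps its leading coefficient, so leading
    coefficients grow with the degree. *)
Let leadS N n h d : gclosed (addop Om T t) N -> lead N n h d -> lead N n.+1 h d.
Proof.
move=> [_ _ NO] [Dd [y [Ly Ny]]]; split=> //; exists (T y).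
rewrite mulSn (addnC t) addnA; split; first exact: layerT.
by rewrite iterS -TD; apply: NO => //; right.
Qed.

(** Hilbert's argument: once the leading coefficients of [N m] and [N n] agree in every degree, an
    element of [N m] can be corrected by one of [N n] with the same leading coefficient, which
    lowers the layer. *)
Theorem gacc_adjoin : gacc Om D -> gacc (addop Om T t) (adjoin D T t).
Proof.
move=> accD N Ncl Ninc.
have Nle m n i x : (m <= n)%N -> N m i x -> N n i x.
  exact: (@chain_incr _ (fun n x => N n i x) (fun n x => Ninc n i x)).
have leadN k m n h d : (m <= n)%N -> lead (N m) k h d -> lead (N n) k h d.
  by move=> mn [Dd [y [Ly Ny]]]; split=> //; exists y; split=> //; apply: Nle Ny.
have leadk k l n h d : (k <= l)%N -> lead (N n) k h d -> lead (N n) l h d.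
  apply: (@chain_incr _ (fun k d => lead (N n) k h d)) => j x.
  exact: leadS.
(* The diagonal chain settles all degrees from [n0] on; the finitely many degrees below [n0] each
   have their own stage. *)
have [n0 Hn0] := accD (fun n => lead (N n) n) (fun n => lead_closed n (Ncl n))
  (fun n i x H => leadS (Ncl _) (leadN _ _ _ _ _ (leqnSn n) H)).
have [n1 Hn1] : exists n1, forall k, (k < n0)%N ->
    forall m h d, (n1 <= m)%N -> lead (N m) k h d -> lead (N n1) k h d.
  apply: uniform_stage => [k n m nm H l h d lm Ll|k].
    exact: (leadN _ _ _ _ _ nm (H _ _ _ (leq_trans nm lm) Ll)).
  have [n H] := accD (fun n => lead (N n) k) (fun n => lead_closed k (Ncl n))
    (fun n i x => leadN _ _ _ _ _ (leqnSn n)).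
  by exists n => m h d nm Ld; exact: (H _ _ _ nm (proj1 Ld) Ld).
pose n := maxn n0 n1.
have leadE k m h d : (n <= m)%N -> lead (N m) k h d -> lead (N n) k h d.
  rewrite /n geq_max => /andP[n0m n1m] Ld.
  case: (ltnP k n0) => [/Hn1 H|n0k].
    by apply: (leadN _ _ _ _ _ (leq_maxr _ _)); apply: H Ld.
  apply: (leadN _ _ _ _ _ (leq_maxl _ _)); apply: (leadk n0) => //.
  apply: (Hn0 (maxn k m)); first by rewrite leq_max n0k.
    by case: Ld.
  by apply: (leadN _ _ _ _ _ (leq_maxr _ _)); apply: (leadk _ _ _ _ _ (leq_maxl _ _)).
exists n => m i x nm [k]; elim: k i x => [|k IH] i x /=.
  by move=> -> _; case: (Ncl n).
have [_ NmB _] := Ncl m; have [_ NB _] := Ncl n.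
move=> [y [z [Ly]]]; case=> [->|[h [d [Dd Ei ->]]]] ->.
  by rewrite addr0; apply: IH.
move=> Nx; have [_ [y' [Ly' Ny']]] : lead (N n) k h d.
  by apply: (leadE _ m) => //; split=> //; exists y; rewrite Ei.
rewrite Ei in Ly' Ny'.
(* The elements [y + T^k d] and [y' + T^k d] both lie in [N m]; their difference has lost the
   leading term. *)
have Nyy : N n i (y' - y).
  apply: IH; first exact: layerB.
  have := NmB _ _ _ (Nle _ _ _ _ nm Ny') Nx.
  by rewrite opprD addrACA subrr addr0.
have := NB _ _ _ Ny' Nyy; rewrite addrAC opprB addrCA subrr addr0.
by rewrite [in X in _ -> X]addrC addrC.
Qed.

End GradedHilbert.

(** * Right modules *)

Definition rmodule (S : nzRingType) (M : zmodType) (act : M -> S -> M) : Prop :=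
  [/\ (forall x, act x 1 = x),
      (forall x y s, act (x + y) s = act x s + act y s),
      (forall x s t, act x (s + t) = act x s + act x t) &
      (forall x s t, act (act x s) t = act x (s * t))].

Definition submod (S : nzRingType) (M : zmodType) (act : M -> S -> M)
  (N : M -> Prop) : Prop :=
  [/\ N 0, (forall x y, N x -> N y -> N (x + y)) &
      (forall x s, N x -> N (act x s))].

Section RModule.

Variables (S : nzRingType) (M : zmodType) (act : M -> S -> M).
Hypothesis Mact : rmodule act.

Lemma act1 x : act x 1 = x. Proof. by case: Mact. Qed.
Lemma actDl x y s : act (x + y) s = act x s + act y s. Proof. by case: Mact. Qed.
Lemma actDr x s t : act x (s + t) = act x s + act x t. Proof. by case: Mact. Qed.
Lemma actA x s t : act (act x s) t = act x (s * t). Proof. by case: Mact. Qed.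
Lemma act0l s : act 0 s = 0.
Proof. by apply: (addrI (act 0 s)); rewrite -actDl !addr0. Qed.
Lemma act0r x : act x 0 = 0.
Proof. by apply: (addrI (act x 0)); rewrite -actDr !addr0. Qed.
Lemma actNl x s : act (- x) s = - act x s.
Proof. by apply/eqP; rewrite -subr_eq0 opprK -actDl addNr act0l. Qed.
Lemma actNr x s : act x (- s) = - act x s.
Proof. by apply/eqP; rewrite -subr_eq0 opprK -actDr addNr act0r. Qed.
Lemma actBl x y s : act (x - y) s = act x s - act y s.
Proof. by rewrite actDl actNl. Qed.
Lemma actBr x s t : act x (s - t) = act x s - act x t.
Proof. by rewrite actDr actNr. Qed.
Lemma act_sumr x (I : Type) (r : seq I) (F : I -> S) :
  act x (\sum_(i <- r) F i) = \sum_(i <- r) act x (F i).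
Proof. by elim/big_rec2: _ => [|i y z _ <-]; rewrite ?act0r ?actDr. Qed.

Section Submod.
Variable N : M -> Prop.
Hypothesis NM : submod act N.
Lemma subm0 : N 0. Proof. by case: NM. Qed.
Lemma submD x y : N x -> N y -> N (x + y). Proof. by case: NM => _ + _; apply. Qed.
Lemma submA x s : N x -> N (act x s). Proof. by case: NM => _ _; apply. Qed.
Lemma submN x : N x -> N (- x).
Proof. by move=> Nx; rewrite -[x]act1 -actNr; apply: submA. Qed.
Lemma submB x y : N x -> N y -> N (x - y).
Proof. by move=> Nx Ny; apply/submD/submN. Qed.
Lemma submBr x y : N y -> N (x - y) -> N x.
Proof. by move=> Ny Nxy; rewrite -(subrK y x); apply: submD. Qed.
Lemma subm_sum (I : Type) (r : seq I) (F : I -> M) :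
  (forall i, N (F i)) -> N (\sum_(i <- r) F i).
Proof. by move=> NF; elim/big_rec: _ => [|i x _ Nx]; [exact: subm0|exact: submD]. Qed.
End Submod.

Lemma submod_zero : submod act (fun x => x = 0).
Proof. by split=> [|x y -> ->|x s ->]; rewrite ?addr0 ?act0l. Qed.

Lemma submod_full : submod act (fun=> True). Proof. by []. Qed.

Definition sumset (N N' : M -> Prop) x := exists y z, [/\ N y, N' z & x = y + z].

Lemma submod_sum N N' : submod act N -> submod act N' -> submod act (sumset N N').
Proof.
move=> sN sN'; split=> [|x y [a [b [Na Nb ->]]] [d [e [Nd Ne ->]]]|x s [a [b [Na Nb ->]]]].
- by exists 0, 0; split; rewrite ?addr0 //; apply: subm0.
- by exists (a + d), (b + e); split; [exact: submD|exact: submD|rewrite addrACA].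
by exists (act a s), (act b s); split; [exact: submA|exact: submA|rewrite actDl].
Qed.

(** The submodule generated by [L] and [gs], by recursion so that generators can be split off one at
    a time. *)
Fixpoint span (L : M -> Prop) (gs : seq M) (x : M) : Prop :=
  if gs is g :: gs' then exists s, span L gs' (x - act g s) else L x.

Lemma span_submod L gs : submod act L -> submod act (span L gs).
Proof.
move=> sL; elim: gs => //= g gs IH; split=> [|x y [s Hs] [t Ht]|x s [t Ht]].
- by exists 0; rewrite act0r subr0; apply: subm0.
- by exists (s + t); rewrite actDr opprD addrACA; apply: submD.
by exists (t * s); rewrite -actA -actBl; apply: submA.
Qed.

Lemma span_base L gs x : submod act L -> L x -> span L gs x.
Proof.
by move=> sL Lx; elim: gs => //= g gs IH; exists 0; rewrite act0r subr0.
Qed.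

Lemma span_gen L gs g : submod act L -> g \in gs -> span L gs g.
Proof.
move=> sL; elim: gs => //= h gs IH; rewrite inE => /orP[/eqP->|/IH H].
  by exists 1; rewrite act1 subrr; exact: (subm0 (span_submod gs sL)).
by exists 0; rewrite act0r subr0.
Qed.

Lemma span_min L gs N : submod act N -> (forall x, L x -> N x) ->
  (forall g, g \in gs -> N g) -> forall x, span L gs x -> N x.
Proof.
move=> sN LN; elim: gs => [|g gs IH] Ngs x //=; first exact: LN.
move=> [s Hs]; apply: (submBr sN (y := act g s)).
  by apply: submA => //; apply: Ngs; rewrite mem_head.
by apply: IH => // h hgs; apply: Ngs; rewrite inE hgs orbT.
Qed.

Definition noeth (U : M -> Prop) : Prop :=
  forall N : nat -> M -> Prop, (forall n, submod act (N n)) ->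
    (forall n x, N n x -> N n.+1 x) ->
    exists n, forall m x, (n <= m)%N -> U x -> N m x -> N n x.

(** A finite list in [U] whose span is maximal on [U] already spans [U]: a missed element could be
    added to it. *)
Lemma noeth_fg (U : M -> Prop) : noeth U ->
  exists gs, (forall g, g \in gs -> U g) /\ forall x, U x -> span (fun x => x = 0) gs x.
Proof.
move=> acc; pose sp := span (fun x : M => x = 0).
have sub_sp gs : submod act (sp gs) by apply/span_submod/submod_zero.
pose F (gs : seq M) := forall g, g \in gs -> U g.
pose lt gs gs' := (forall x, sp gs x -> sp gs' x) /\
   exists x, [/\ U x, sp gs' x & ~ sp gs x].
have [||gs [Fgs Hmax]] := @exists_maximal _ lt F _ [::] _ => //.
  move=> f Ff; apply: NNPP => H.
  have H' n : lt (f n) (f n.+1) by apply: NNPP => Hn; apply: H; exists n.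
  have [n Hn] := acc (fun n => sp (f n)) (fun n => sub_sp _) (fun n => proj1 (H' n)).
  have [_ [x [Ux spx]]] := H' n; apply; exact: Hn (leqnSn n) Ux spx.
exists gs; split=> // x Ux; apply: NNPP => nx.
apply: (Hmax (x :: gs)).
  by move=> g; rewrite inE => /orP[/eqP->|/Fgs].
split=> [y spy|]; first by exists 0; rewrite act0r subr0.
exists x; split=> //; exists 1; rewrite act1 subrr.
exact: subm0.
Qed.

Lemma noethS (U U' : M -> Prop) : (forall x, U' x -> U x) -> noeth U -> noeth U'.
Proof.
move=> UU' acc N sN inc; have [n Hn] := acc N sN inc; exists n => m x nm /UU'.
exact: Hn.
Qed.

End RModule.

(** * Descending chains up to torsion *)

Section TorsionDcc.

Variables (R : comNzRingType) (c : R).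

(* Descending chains of submodules become stationary between [L] and [U] after
   inverting [c]; stated so that no localisation has to be built. *)
Definition tdcc (M : zmodType) (act : M -> R -> M) (L U : M -> Prop) : Prop :=
  forall N : nat -> M -> Prop, (forall n, submod act (N n)) ->
    (forall n x, N n.+1 x -> N n x) ->
    exists n, forall m x, (n <= m)%N -> N n x -> U x ->
      exists j l, L l /\ N m (act x (c ^+ j) - l).

Section OneModule.

Variables (M : zmodType) (act : M -> R -> M).
Hypothesis Mact : rmodule act.

(** The correction [w] produced over [W] lies again in an earlier term of the chain, so it can be
    corrected a second time over [L]. *)
Lemma tdcc_trans L W U : tdcc act L W -> tdcc act W U -> tdcc act L U.
Proof.
move=> dLW dWU N sN dec.
have [n1 H1] := dWU N sN dec; have [n2 H2] := dLW N sN dec.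
exists (maxn n1 n2) => m x nm Nx Ux.
have le1 := leq_maxl n1 n2; have le2 := leq_maxr n1 n2.
have [j [w [Ww Nm]]] := H1 m x (leq_trans le1 nm) (chain_decr dec le1 Nx) Ux.
have Nw : N n2 w.
  rewrite -[w](subKr (act x (c ^+ j))); apply: (submB Mact (sN _)).
    exact: (submA (sN n2) _ (chain_decr dec le2 Nx)).
  exact: (chain_decr dec (leq_trans le2 nm) Nm).
have [k [l [Ll Nl]]] := H2 m w (leq_trans le2 nm) Nw Ww.
exists (j + k)%N, l; split=> //.
have -> : act x (c ^+ (j + k)) - l =
   act (act x (c ^+ j) - w) (c ^+ k) + (act w (c ^+ k) - l).
  by rewrite exprD actBl // actA // addrA subrK.
by apply: (submD (sN m)) => //; apply: (submA (sN m)).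
Qed.

Lemma tdcc_mono (L L' U U' : M -> Prop) : (forall x, L x -> L' x) ->
  (forall x, U' x -> U x) -> tdcc act L U -> tdcc act L' U'.
Proof.
move=> LL UU d N sN dec; have [n H] := d N sN dec; exists n => m x nm Nx /UU Ux.
by have [j [l [/LL Ll Nl]]] := H m x nm Nx Ux; exists j, l.
Qed.

Lemma tdcc_torsion (L U : M -> Prop) :
  (forall x, U x -> exists j, L (act x (c ^+ j))) -> tdcc act L U.
Proof.
move=> H N sN _; exists 0%N => m x _ _ /H [j Lj]; exists j, (act x (c ^+ j)).
by split=> //; rewrite subrr; apply: (subm0 (sN m)).
Qed.

Lemma tdcc_refl (L : M -> Prop) : tdcc act L L.
Proof. by apply: tdcc_torsion => x Lx; exists 0%N; rewrite expr0 act1. Qed.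

(** Up to torsion, [U / L] is built from finitely many cyclic modules that are quotients of [R / P],
    added one generator at a time. *)
Lemma tdcc_span (P : R -> Prop) (L U : M -> Prop) gs :
  tdcc *%R P (fun=> True) -> submod act L ->
  (forall g p, g \in gs -> P p -> L (act g p)) ->
  (forall x, U x -> exists j, span act L gs (act x (c ^+ j))) ->
  tdcc act L U.
Proof.
move=> dP sL PL Ugs; apply: tdcc_trans (tdcc_torsion Ugs).
elim: gs PL {Ugs} => [|g gs IH] PL /=; first exact: tdcc_refl.
have sS := span_submod Mact gs sL.
apply: tdcc_trans (IH _) _ => [h p hgs|].
  by apply: PL; rewrite inE hgs orbT.
move=> N sN dec.
(* The coefficients that [g] can have in elements of [N n] form a descending chain of ideals. *)
pose A n r := exists y, span act L gs y /\ N n (act g r + y).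
have sA n : submod *%R (A n).
  split=> [|r s [y [Sy Ny]] [z [Sz Nz]]|r s [y [Sy Ny]]].
  - exists 0; split; first exact: (subm0 sS).
    by rewrite act0r // addr0; apply: (subm0 (sN n)).
  - exists (y + z); split; first exact: (submD sS).
    by rewrite actDr // addrACA; apply: (submD (sN n)).
  exists (act y s); split; first exact: (submA sS).
  by rewrite -actA // -actDl //; apply: (submA (sN n)).
have [|n Hn] := dP A sA; first by move=> n r [y [Sy /dec Ny]]; exists y.
exists n => m x nm Nx [r Sx].
have [|j [p [Pp [y [Sy Ny]]]]] := Hn m r nm _ I.
  by exists (x - act g r); split=> //; rewrite addrC subrK.
exists j, (act x (c ^+ j) - (act g (r * c ^+ j - p) + y)); rewrite subKr; split=> //.
have -> : act x (c ^+ j) - (act g (r * c ^+ j - p) + y) =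
    act (x - act g r) (c ^+ j) + act g p - y.
  by rewrite actBl // actBr // actA // opprD addrA opprB addrA (addrAC _ (act g p)).
apply: (submB Mact sS) => //; apply: (submD sS); first exact: (submA sS).
by apply: span_base => //; apply: PL; rewrite ?mem_head.
Qed.

(* Stationarity up to torsion becomes true stationarity for chains on which
   division by [c] is possible. *)
Lemma tdcc_stationary (L U : M -> Prop) (N : nat -> M -> Prop) :
  tdcc act L U -> (forall x r, U x -> U (act x r)) -> (forall n, submod act (N n)) ->
  (forall n x, N n.+1 x -> N n x) ->
  (forall n x, U x -> sumset (N n) L (act x c) -> sumset (N n) L x) ->
  (exists n, forall m x, (n <= m)%N -> N n x -> L x -> N m x) ->
  exists n, forall m x, (n <= m)%N -> N n x -> U x -> N m x.
Proof.
move=> dLU UA sN dec cdiv [n1 H1]; have [n2 H2] := dLU N sN dec.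
exists (maxn n1 n2) => m x nm Nx Ux.
have le1 := leq_maxl n1 n2; have le2 := leq_maxr n1 n2.
have [j [l [Ll Nm]]] := H2 m x (leq_trans le2 nm) (chain_decr dec le2 Nx) Ux.
have : sumset (N m) L (act x (c ^+ j)).
  by exists (act x (c ^+ j) - l), l; rewrite subrK.
elim: j {Nm} => [|j IH]; last first.
  by rewrite exprSr -actA // => /cdiv H; apply/IH/H/UA.
rewrite expr0 act1 // => -[y [z [Ny Lz Ex]]].
rewrite Ex; apply: (submD (sN m)) => //.
apply: (H1 m _ (leq_trans le1 nm)) => //.
have -> : z = x - y by rewrite Ex addrC addKr.
apply: (submB Mact (sN n1)); first exact: (chain_decr dec le1 Nx).
exact: (chain_decr dec (leq_trans le1 nm) Ny).
Qed.

End OneModule.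

(** [phi] embeds [U / L] into [U' / L']. It is only semilinear, but [be] is onto, so images of
    submodules are submodules. *)
Lemma tdcc_transfer (M M' : zmodType) (act : M -> R -> M) (act' : M' -> R -> M')
    (L U : M -> Prop) (L' U' : M' -> Prop) (phi : M -> M') (be ga : R -> R) :
  rmodule act -> rmodule act' ->
  submod act U -> submod act' L' ->
  (forall x y, phi (x - y) = phi x - phi y) ->
  (forall x r, U x -> phi (act x r) = act' (phi x) (be r)) ->
  (forall r, be (ga r) = r) ->
  (forall x, U x -> L' (phi (act x c) - act' (phi x) c)) ->
  (forall x, U x -> U' (phi x)) -> (forall x, U x -> L' (phi x) -> L x) ->
  tdcc act' L' U' -> tdcc act L U.
Proof.
move=> Mact Mact' sU sL' phiB phiA bega phic UU LL d N sN dec.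
have phi0 : phi 0 = 0 by rewrite -(subrr 0) phiB !subrr.
have phiN x : phi (- x) = - phi x by rewrite -sub0r phiB phi0 sub0r.
have phiD x y : phi (x + y) = phi x + phi y by rewrite -[y in LHS]opprK phiB phiN opprK.
have phicj j x : U x -> L' (phi (act x (c ^+ j)) - act' (phi x) (c ^+ j)).
  move=> Ux; elim: j => [|j IH].
    by rewrite !expr0 !act1 // subrr; apply: (subm0 sL').
  rewrite exprSr -!actA //.
  have := submD sL' (phic _ (submA sU (c ^+ j) Ux)) (submA sL' c IH).
  by rewrite actBl // addrA subrK.
pose N' n y := exists x, [/\ N n x, U x & y = phi x].
have sN' n : submod act' (N' n).
  split=> [|_ _ [x [Nx Ux ->]] [y [Ny Uy ->]]|_ r [x [Nx Ux ->]]].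
  - by exists 0; split; rewrite ?phi0 //; [apply: (subm0 (sN n))|apply: (subm0 sU)].
  - by exists (x + y); split; rewrite ?phiD //; [apply: (submD (sN n))|apply: (submD sU)].
  by exists (act x (ga r)); split; rewrite ?phiA ?bega //; [apply: (submA (sN n))|apply: (submA sU)].
have [|n Hn] := d N' sN'; first by move=> n _ [x [/dec Nx Ux ->]]; exists x.
exists n => m x nm Nx Ux.
have [|j [l [Ll [y [Ny Uy E]]]]] := Hn m (phi x) nm _ (UU _ Ux); first by exists x.
exists j, (act x (c ^+ j) - y); rewrite subKr; split=> //.
apply: LL; first by apply: (submB Mact sU) => //; apply: (submA sU).
rewrite phiB -E.
have -> : phi (act x (c ^+ j)) - (act' (phi x) (c ^+ j) - l) =
  phi (act x (c ^+ j)) - act' (phi x) (c ^+ j) + l by rewrite opprB addrA addrAC.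
by apply: (submD sL') => //; apply: phicj.
Qed.

(* After inverting [c], the quotient by [m] is a field or zero. *)
Definition cmaximal (m : R -> Prop) : Prop :=
  submod *%R m /\ forall r, ~ m r -> exists N d, m (c ^+ N - r * d).

(** The ring is filtered by the intersections [I j] of the first [j] ideals. Each quotient
    [I j / I j.+1] embeds into [R / m j], which is a field or zero after inverting [c]. *)
Lemma tdcc_cmaximal (P : R -> Prop) (m : nat -> R -> Prop) k :
  (forall i, (i < k)%N -> cmaximal (m i)) ->
  (forall r, (forall i, (i < k)%N -> m i r) -> P r) ->
  tdcc *%R P (fun=> True).
Proof.
have Rm : rmodule (@GRing.mul R).
  by split=> *; rewrite ?mulr1 ?mulrDl ?mulrDr ?mulrA.
pose I j r := forall i, (i < j)%N -> m i r.
move=> mmax IP.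
suff H j : (j <= k)%N -> tdcc *%R (I j) (fun=> True).
  by apply: tdcc_mono (H k (leqnn k)) => // r Ir; apply: IP.
elim: j => [_|j IH jk].
  by apply: tdcc_torsion => x _; exists 0%N.
apply: (tdcc_trans Rm) (IH (ltnW jk)); have [sm mj] := mmax j jk.
have Imul l r s : (l <= k)%N -> I l r -> I l (r * s).
  by move=> lk Ir i ij; apply: submA (Ir i ij); case: (mmax i (leq_trans ij lk)).
have IS r : I j r -> m j r -> I j.+1 r.
  by move=> Ir mr i; rewrite ltnS leq_eqVlt => /orP[/eqP->//|/Ir].
move=> N sN dec.
(* Either some term of the chain meets [I j] inside [m j], or every term contains some [y] of [I j]
   outside [m j], and then a multiple of [y] is a power of [c] modulo [m j]. *)
case: (classic (exists n, forall x, N n x -> I j x -> m j x)) => [[n Hn]|H].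
  exists n => l x nl Nx Ix; exists 0%N, x; rewrite expr0 mulr1 subrr.
  by split; [apply: IS => //; apply: Hn|apply: (subm0 (sN l))].
exists 0%N => l x _ Nx Ix.
have [y [Ny Iy my]] : exists y, [/\ N l y, I j y & ~ m j y].
  apply: NNPP => H'; apply: H; exists l => y Ny Iy; apply: NNPP => my.
  by apply: H'; exists y.
have [n [d md]] := mj y my.
exists n, (x * (c ^+ n - y * d)); split.
  apply: IS; first by apply: Imul => //; apply: ltnW.
  by rewrite mulrC; apply: (submA sm).
by rewrite -mulrBr subKr mulrCA; apply: (submA (sN l)).
Qed.

End TorsionDcc.

(** * Noetherian modules with a semilinear operator *)

Lemma noeth_span (R : comNzRingType) (M : zmodType) (act : M -> R -> M) (gs : seq M) :
  rmodule act -> noeth (@GRing.mul R) (fun=> True) ->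
  noeth act (span act (fun x => x = 0) gs).
Proof.
move=> Mact noeR; elim: gs => [|g gs IH] N sN inc /=.
  by exists 0%N => m x _ -> _; apply: (subm0 (sN _)).
pose sp := span act (fun x => x = 0) gs.
have sS : submod act sp by apply: (span_submod Mact); apply: submod_zero.
pose A n r := exists y, sp y /\ N n (act g r + y).
have sA n : submod *%R (A n).
  split=> [|r s [y [Sy Ny]] [z [Sz Nz]]|r s [y [Sy Ny]]].
  - exists 0; split; first exact: (subm0 sS).
    by rewrite act0r // addr0; apply: (subm0 (sN n)).
  - exists (y + z); split; first exact: (submD sS).
    by rewrite actDr // addrACA; apply: (submD (sN n)).
  exists (act y s); split; first exact: (submA sS).
  by rewrite -actA // -actDl //; apply: (submA (sN n)).
have [|n1 H1] := noeR A sA; first by move=> n r [y [Sy /inc Ny]]; exists y.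
have [n2 H2] := IH N sN inc.
exists (maxn n1 n2) => m x nm [r Sx] Nx.
have le1 := leq_maxl n1 n2; have le2 := leq_maxr n1 n2.
have [|y [Sy Ny]] := H1 m r (leq_trans le1 nm) I.
  by exists (x - act g r); split=> //; rewrite addrC subrK.
apply: (submBr (sN _) (y := act g r + y)); first exact: (chain_incr inc le1 Ny).
apply: (chain_incr inc le2); apply: (H2 m _ (leq_trans le2 nm)).
  by rewrite opprD addrA; apply: (submB Mact sS).
apply: (submB Mact (sN m)) => //.
exact: (chain_incr inc (leq_trans le1 nm) Ny).
Qed.

Section SemilinearOperator.

Variables (R : comNzRingType) (M : zmodType) (act : M -> R -> M).
Variables (T : M -> M) (be ga : R -> R) (gs : seq M).
Hypothesis Mact : rmodule act.
Hypothesis noeR : noeth (@GRing.mul R) (fun=> True).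
Hypothesis TB : forall x y, T (x - y) = T x - T y.
Hypothesis TR : forall x r, T (act x r) = act (T x) (be r).
Hypothesis bega : cancel ga be.

Definition stable (W : M -> Prop) := submod act W /\ forall x, W x -> W (T x).

Hypothesis gsT : forall W, stable W -> (forall g, g \in gs -> W g) -> forall x, W x.

Let OmR (o : M -> M) (d : nat) := d = 0%N /\ exists r, o = act^~ r.

Let D0 i x := if i is 0 then span act (fun x => x = 0) gs x else x = 0.

Let actB r x y : act (x - y) r = act x r - act y r.
Proof. exact: (actBl Mact). Qed.

Let D0sub i : submod act (D0 i).
Proof.
by case: i => [|i]; [apply: (span_submod Mact)|]; apply: submod_zero.
Qed.

Let D0_closed : gclosed OmR D0.
Proof.
split=> [i|i x y|o d [-> [r ->]] i x]; first exact: (subm0 (D0sub i)).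
  exact: (submB Mact (D0sub i)).
by rewrite addn0; apply: (submA (D0sub i)).
Qed.

Let closed_submod (Om : (M -> M) -> nat -> Prop) N i :
  (forall o d, OmR o d -> Om o d) -> gclosed Om N -> submod act (N i).
Proof.
move=> sOm [N0 NB NO]; split=> // [x y Nx Ny|x r Nx].
  by rewrite -[y]opprK; apply: (NB i) => //; rewrite -sub0r; apply: (NB i).
by rewrite -[i]addn0; apply: (NO (act^~ r)) => //; apply: sOm; split=> //; exists r.
Qed.

Let gacc_D0 : gacc OmR D0.
Proof.
move=> N Ncl inc.
have sN n i : submod act (N n i) by apply: closed_submod (Ncl n).
have [n Hn] := @noeth_span _ _ _ gs Mact noeR (fun n => N n 0%N) (fun n => sN n 0%N)
  (fun n => inc n 0%N).
exists n => m [|i] x nm; first exact: Hn.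
by move=> -> _; apply: (subm0 (sN _ _)).
Qed.

(** The graded basis theorem with everything in degree 0: adjoining [T] to the finitely generated
    [R]-module [D0] yields all of [M]. *)
Lemma operator_noeth (N : nat -> M -> Prop) : (forall n, stable (N n)) ->
  (forall n x, N n x -> N n.+1 x) ->
  exists n, forall m x, (n <= m)%N -> N m x -> N n x.
Proof.
move=> sN inc; pose N' n i x := if i is 0 then N n x else x = 0.
have T0 : T 0 = 0 by rewrite -(subrr 0) TB !subrr.
have sN' n i : submod act (N' n i).
  by case: i => [|i]; [case: (sN n)|apply: submod_zero].
have OmRB o d : OmR o d -> forall x y, o (x - y) = o x - o y.
  by move=> [_ [r ->]] x y; apply: actB.
have cl : gclosed (addop OmR T 0) (adjoin D0 T 0) by
  apply: adjoin_closed => // o d [-> [r ->]]; exists (act^~ (ga r));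
  split=> [|x]; [split=> //; exists (ga r)|rewrite TR bega].
have acc : gacc (addop OmR T 0) (adjoin D0 T 0).
  apply: gacc_adjoin => // o d [-> [r ->]].
    exists (act^~ (be r)); split=> [|x]; last exact: TR.
    by split=> //; exists (be r).
  exists (act^~ (ga r)); split=> [|x]; last by rewrite TR bega.
  by split=> //; exists (ga r).
have [||n Hn] := acc N'.
- move=> n; split=> [i|i x y|o d oO i x]; first exact: (subm0 (sN' n i)).
    exact: (submB Mact (sN' n i)).
  case: oO => [[-> [r ->]]|[-> ->]]; rewrite addn0.
    exact: (submA (sN' n i)).
  by case: i => [|i] /=; [case: (sN n) => _; apply|move=> ->].
- by move=> n [|i] x; [apply: inc|].
exists n => m x nm Nx; apply: (Hn m 0%N) => //.
apply: gsT => [|g ggs].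
  split; first by apply: closed_submod cl; left.
  by move=> y; have [_ _ H] := cl; rewrite -{2}[0%N]addn0; apply: H; right.
by apply: adjoin_sub; apply: (span_gen Mact) => //; apply: submod_zero.
Qed.

(** * Artin-Rees for a stable ideal *)

Variables (P : R -> Prop) (E : M -> Prop).
Hypothesis PI : submod *%R P.
Hypothesis Pbe : forall p, P p -> P (be p).
Hypothesis Pga : forall p, P p -> P (ga p).
Hypothesis sE : stable E.
Hypothesis EP : forall x p, E x -> P p -> act x p = 0.

(* The submodule [M P^i]. *)
Fixpoint pow_mod (i : nat) (x : M) : Prop :=
  if i is i'.+1 then
    forall W, stable W -> (forall y p, pow_mod i' y -> P p -> W (act y p)) -> W x
  else True.

Lemma pow_mod_stable i : stable (pow_mod i).
Proof.
case: i => [|i] //; split=> [|x Hx W sW WP]; last first.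
  by apply: (proj2 sW); apply: Hx.
split=> [W [sW _] _|x y Hx Hy W sW WP|x r Hx W sW WP]; first exact: (subm0 sW).
  by apply: (submD (proj1 sW)); [apply: Hx|apply: Hy].
by apply: (submA (proj1 sW)); apply: Hx.
Qed.

Let Oml ps := foldr (fun p Om => addop Om (act^~ p) 1) OmR ps.
Let Dl ps := foldr (fun p D => adjoin D (act^~ p) 1) D0 ps.
(** All of [P] acts in degree one, and not only the generators in [Oml]: [T] turns multiplication by
    a generator [p] into multiplication by [be p], which need not be a generator. *)
Let OmP (o : M -> M) (d : nat) :=
  OmR o d \/ d = 1%N /\ exists p, P p /\ o = act^~ p.

Let Oml_act ps o d : Oml ps o d -> exists r, o = act^~ r.
Proof. by elim: ps => [|p ps IH] /=; [case|case=> [/IH|[-> _]]; last exists p]. Qed.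

Let OmR_Oml ps o d : OmR o d -> Oml ps o d.
Proof. by elim: ps => //= p ps IH /IH; left. Qed.

Let Oml_comm ps p o d : Oml ps o d ->
  exists o', Oml ps o' d /\ forall x, act (o x) p = o' (act x p).
Proof.
move=> oO; exists o; split=> // x; have [r ->] := Oml_act oO.
by rewrite !(actA Mact) mulrC.
Qed.

Let OmlB ps o d : Oml ps o d -> forall x y, o (x - y) = o x - o y.
Proof. by move=> /Oml_act [r ->] x y; apply: actB. Qed.

Let Oml_comm' ps p o d : Oml ps o d ->
  exists o', Oml ps o' d /\ forall x, o (act x p) = act (o' x) p.
Proof.
move=> oO; exists o; split=> // x; have [r ->] := Oml_act oO.
by rewrite !(actA Mact) mulrC.
Qed.

Let Dl_closed ps : gclosed (Oml ps) (Dl ps).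
Proof.
elim: ps => [|p ps IH]; first exact: D0_closed.
apply: adjoin_closed IH (@OmlB ps) _ _ => [x y|]; first exact: actB.
exact: Oml_comm'.
Qed.

Let gacc_Dl ps : gacc (Oml ps) (Dl ps).
Proof.
elim: ps => [|p ps IH]; first exact: gacc_D0.
apply: gacc_adjoin (Dl_closed ps) (@OmlB ps) _ _ _ IH => [x y||].
- exact: actB.
- exact: Oml_comm.
exact: Oml_comm'.
Qed.

(* Artin-Rees for [E] inside [M] with respect to [P], in the only case needed:
   the chain [E_j = (+)_(i <= j) E cap M P^i] of graded submodules of the Rees
   module stabilises. *)
Lemma artin_rees : exists j, forall x, E x -> pow_mod j x -> x = 0.
Proof.
have Rm : rmodule (@GRing.mul R).
  by split=> *; rewrite ?mulr1 ?mulrDl ?mulrDr ?mulrA.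
have T0 : T 0 = 0 by rewrite -(subrr 0) TB !subrr.
have [|ps [psP Pps]] := @noeth_fg _ _ _ Rm P; first by apply: noethS noeR.
(* The [r] that send [N i] into [N (i + 1)] for every [i] form an ideal, so the generators
   suffice. *)
have OmPl N : gclosed (Oml ps) N -> gclosed OmP N.
  move=> Ncl; have [N0 NB NO] := Ncl; split=> // o d [oR|[-> [p [Pp ->]]]].
    exact: NO (OmR_Oml _ oR).
  have sN i : submod act (N i) by apply: closed_submod Ncl => o' d'; apply: OmR_Oml.
  pose W r := forall i x, N i x -> N (i + 1)%N (act x r).
  suff : W p by apply.
  apply: (@span_min _ _ _ (fun x => x = 0) ps W) (Pps p Pp) => [|r ->|q qps].
  - split=> [i x Nx|r s Wr Ws i x Nx|r s Wr i x Nx].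
    + by rewrite (act0r Mact); apply: (subm0 (sN _)).
    + by rewrite (actDr Mact); apply: (submD (sN _)); [apply: Wr|apply: Ws].
    by rewrite -(actA Mact); apply: (submA (sN _)); apply: Wr.
  - by move=> i x Nx; rewrite (act0r Mact); apply: (subm0 (sN _)).
  move=> i x; apply: (NO (act^~ q)); elim: (ps) qps => //= q' qs IH.
  by rewrite inE => /orP[/eqP->|/IH]; [right|left].
have Omps o d : Oml ps o d -> OmP o d.
  elim: (ps) psP => [|q qs IH] qsP /=; first by left.
  case=> [|[-> ->]]; first by apply: IH => g gqs; apply: qsP; rewrite inE gqs orbT.
  by right; split=> //; exists q; split=> //; apply: qsP; rewrite mem_head.
have accP : gacc OmP (Dl ps).
  move=> N Ncl inc; apply: (gacc_Dl (ps := ps)) => // n.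
  by have [N0 NB NO] := Ncl n; split=> // o d /Omps oO; apply: NO.
have OmPB o d : OmP o d -> forall x y, o (x - y) = o x - o y.
  by case=> [[_ [r ->]]|[_ [p [_ ->]]]] x y; apply: actB.
have TOm o d : OmP o d -> exists o', OmP o' d /\ forall x, T (o x) = o' (T x).
  case=> [[-> [r ->]]|[-> [p [Pp ->]]]].
    exists (act^~ (be r)); split=> [|x]; last exact: TR.
    by left; split=> //; exists (be r).
  exists (act^~ (be p)); split=> [|x]; last exact: TR.
  by right; split=> //; exists (be p); split=> //; apply: Pbe.
have OmT o d : OmP o d -> exists o', OmP o' d /\ forall x, o (T x) = T (o' x).
  case=> [[-> [r ->]]|[-> [p [Pp ->]]]].
    exists (act^~ (ga r)); split=> [|x]; last by rewrite TR bega.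
    by left; split=> //; exists (ga r).
  exists (act^~ (ga p)); split=> [|x]; last by rewrite TR bega.
  by right; split=> //; exists (ga p); split=> //; apply: Pga.
have cl := @adjoin_closed _ OmP _ T 0 (OmPl _ (Dl_closed ps)) OmPB TB OmT.
have acc := @gacc_adjoin _ OmP _ T 0 (OmPl _ (Dl_closed ps)) OmPB TB TOm OmT accP.
set G := adjoin _ _ _ in cl acc.
have stG i : stable (G i).
  split; first by apply: closed_submod cl => o d oR; left; left.
  by move=> x; have [_ _ H] := cl; rewrite -{2}[i]addn0; apply: H; right.
have GM i x : pow_mod i x -> G i x.
  elim: i x => [|i IH] x /=.
    move=> _; apply: gsT => // g ggs.
    apply: adjoin_sub.
    have : D0 0 g by apply: (span_gen Mact) => //; apply: submod_zero.
    by elim: (ps) => // q qs IHq /IHq; apply: adjoin_sub.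
  apply=> // y p /IH Gy Pp; have [_ _ H] := cl; rewrite -addn1.
  by apply: (H (act^~ p)) => //; left; right; split=> //; exists p.
pose N j i x := x = 0 \/ [/\ (i <= j)%N, E x & pow_mod i x].
have [||j Hj] := acc N.
- move=> j; split=> [i|i x y|o d oO i x].
  + by left.
  + have [spi _] := pow_mod_stable i; have [spE _] := sE.
    case=> [->|[ij Ex Mx]] [->|[ij' Ey My]].
    * by left; rewrite subrr.
    * by right; rewrite sub0r; split=> //; [apply: (submN Mact spE)|apply: (submN Mact spi)].
    * by right; rewrite subr0.
    by right; split=> //; [apply: (submB Mact spE)|apply: (submB Mact spi)].
  have [spi Tpi] := pow_mod_stable i; have [spE TE] := sE.
  case: oO => [[[-> [r ->]]|[-> [p [Pp ->]]]]|[-> ->]].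
  + rewrite addn0; case=> [->|[ij Ex Mx]]; first by left; rewrite (act0l Mact).
    by right; split=> //; [apply: (submA spE)|apply: (submA spi)].
  + by case=> [->|[ij Ex Mx]]; left; rewrite ?(act0l Mact) ?EP.
  rewrite addn0; case=> [->|[ij Ex Mx]]; first by left.
  by right; split=> //; [apply: TE|apply: Tpi].
- move=> j i x [->|[ij Ex Mx]]; first by left.
  by right; split=> //; apply: leqW.
(* In degree [j.+1] the component of [N j] is zero, while that of [N j.+1] is the intersection of
   [E] with [M P^(j+1)]. *)
exists j.+1 => x Ex Mx.
have [//|[]] : N j j.+1 x; last by rewrite ltnn.
apply: (Hj j.+1) => //; first exact: GM.
by right; split.
Qed.

End SemilinearOperator.

(** * Skew polynomial extensions *)

(* Uniqueness of the coefficients is never needed, so a skew polynomial extension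
   is any ring generated over [R] by an element [th] with [th r = al(r) th]. *)
Record skew_ext (R : comNzRingType) (S : nzRingType) (io : {rmorphism R -> S})
  (al : {rmorphism R -> R}) (ali : R -> R) (th : S) : Prop := SkewExt {
  alK : cancel al ali;
  aliK : cancel ali al;
  thR : forall r, th * io r = io (al r) * th;
  skew_gen : forall s, exists n (r : nat -> R), s = \sum_(i < n) io (r i) * th ^+ i;
  skew_noeth : noeth (@GRing.mul R) (fun=> True)
}.

(** Partial right inverses of [c] can be combined: a product of factors [1 - c * u] has again this
    form, so defects are removed one after another. *)
Lemma one_subM (S : nzRingType) (c u v : S) :
  (1 - c * u) * (1 - c * v) = 1 - c * (v + u - u * c * v).
Proof.
rewrite mulrBr mulr1 mulrBl mul1r [in RHS]mulrBr mulrDr !mulrA !opprB opprD.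
by rewrite !addrA [RHS]addrAC (addrAC 1).
Qed.

Section Skew.

Variables (R : comNzRingType) (S : nzRingType) (io : {rmorphism R -> S}).
Variables (al : {rmorphism R -> R}) (ali : R -> R) (th : S).
Hypothesis SE : skew_ext io al ali th.

Lemma regular_rmodule : rmodule (@GRing.mul R).
Proof. by split=> *; rewrite ?mulr1 ?mulrDl ?mulrDr ?mulrA. Qed.

Lemma Rth r : io r * th = th * io (ali r).
Proof. by rewrite (thR SE) (aliK SE). Qed.

Lemma thnR n r : th ^+ n * io r = io (iter n al r) * th ^+ n.
Proof.
elim: n => [|n IH]; first by rewrite expr0 mul1r mulr1.
by rewrite exprS -mulrA IH mulrA (thR SE) iterS -mulrA.
Qed.

Lemma iter_aliK n : cancel (iter n ali) (iter n al).
Proof. by elim: n => // n IH r; rewrite iterSr iterS (aliK SE) IH. Qed.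

Lemma iter_alK n : cancel (iter n al) (iter n ali).
Proof. by elim: n => // n IH r; rewrite iterSr iterS (alK SE) IH. Qed.

Lemma Rthn n r : io r * th ^+ n = th ^+ n * io (iter n ali r).
Proof. by rewrite thnR iter_aliK. Qed.

(** Left multiplication by [th] is a semilinear operator on the [R]-module [S], and 1 generates [S]
    under it. *)
Lemma left_noeth (N : nat -> S -> Prop) :
  (forall n, [/\ N n 0, (forall x y, N n x -> N n y -> N n (x + y)) &
                 (forall s x, N n x -> N n (s * x))]) ->
  (forall n x, N n x -> N n.+1 x) ->
  exists n, forall m x, (n <= m)%N -> N m x -> N n x.
Proof.
move=> sN inc; pose act x r := io r * x.
have Mact : rmodule act.
  split=> *; rewrite /act ?rmorph1 ?mul1r ?mulrDr ?rmorphD ?mulrDl //.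
  by rewrite mulrA -rmorphM mulrC.
apply: (@operator_noeth _ _ act ( *%R th) al ali [:: 1]) => //.
- exact: skew_noeth SE.
- by move=> x y; rewrite mulrBr.
- by move=> x r; rewrite /act mulrA (thR SE) mulrA.
- exact: aliK SE.
- move=> W [sW WT] W1 s; have [n [r ->]] := skew_gen SE s.
  apply: (subm_sum sW) => i; rewrite Rthn.
  elim: (nat_of_ord i) (iter i ali _) => [|k IH] q.
    by rewrite mul1r -[io q]mulr1; apply: (submA sW (x := 1)); apply: W1; rewrite inE.
  by rewrite exprS -mulrA; apply: WT.
move=> n; have [N0 ND NM] := sN n; split=> [|x]; last exact: NM.
by split=> // x r; apply: NM.
Qed.

Section SkewModule.

Variables (M : zmodType) (act : M -> S -> M).
Hypothesis Mact : rmodule act.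

Definition actR (x : M) (r : R) := act x (io r).

Lemma actR_rmodule : rmodule actR.
Proof.
split=> *; rewrite /actR ?rmorph1 ?rmorphD ?rmorphM.
- exact: (act1 Mact).
- exact: (actDl Mact).
- exact: (actDr Mact).
exact: (actA Mact).
Qed.

Lemma actRth x r : act (act x (io r)) th = act (act x th) (io (ali r)).
Proof. by rewrite !(actA Mact) Rth. Qed.

Lemma actthR x r : act (act x th) (io r) = act (act x (io (al r))) th.
Proof. by rewrite !(actA Mact) (thR SE). Qed.

Lemma actRC x p r : act (act x (io p)) (io r) = act (act x (io r)) (io p).
Proof. by rewrite !(actA Mact) -!rmorphM mulrC. Qed.

Lemma submodR N : submod act N -> submod actR N.
Proof. by case=> N0 ND NM; split=> // x r; apply: NM. Qed.

Lemma submod_gen (N : M -> Prop) : N 0 -> (forall x y, N x -> N y -> N (x + y)) ->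
  (forall x r, N x -> N (act x (io r))) -> (forall x, N x -> N (act x th)) ->
  submod act N.
Proof.
move=> N0 ND NR Nth; split=> // x s Nx; have [n [r ->]] := skew_gen SE s.
rewrite (act_sumr Mact); elim/big_rec: _ => // i y _ Ny; apply: ND => //.
rewrite -(actA Mact); move: (r i) => q; elim: (nat_of_ord i) => [|k IH].
  by rewrite (act1 Mact); apply: NR.
by rewrite exprSr -(actA Mact); apply: Nth.
Qed.

Lemma skew_module_noeth gs : (forall x, span act (fun x => x = 0) gs x) ->
  noeth act (fun=> True).
Proof.
move=> Mgs N sN inc.
have [|||||||n Hn] := @operator_noeth _ _ actR (act^~ th) ali al gs _ _ _ _ _ _ N _ inc.
- exact: actR_rmodule.
- exact: skew_noeth SE.
- by move=> x y; apply: (actBl Mact).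
- by move=> x r; apply: actRth.
- exact: alK SE.
- move=> W [[W0 WD WR] WT] Wgs x.
  have sW : submod act W by apply: submod_gen.
  by apply: (span_min sW _ Wgs (Mgs x)) => y ->.
- by move=> n; split; [apply: submodR|move=> x; apply: (submA (sN n))].
by exists n => m x nm _; apply: Hn.
Qed.

Lemma skew_module_artin_rees gs (P : R -> Prop) (E : M -> Prop) :
  (forall x, span act (fun x => x = 0) gs x) ->
  submod *%R P -> (forall p, P p -> P (al p)) -> (forall p, P p -> P (ali p)) ->
  submod act E -> (forall x p, E x -> P p -> act x (io p) = 0) ->
  exists j, forall x, E x -> pow_mod actR (act^~ th) P j x -> x = 0.
Proof.
move=> Mgs PI Pal Pali sE EP.
apply: (@artin_rees _ _ actR (act^~ th) ali al gs) => //.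
- exact: actR_rmodule.
- exact: skew_noeth SE.
- by move=> x y; apply: (actBl Mact).
- by move=> x r; apply: actRth.
- exact: alK SE.
- move=> W [[W0 WD WR] WT] Wgs x.
  have sW : submod act W by apply: submod_gen.
  by apply: (span_min sW _ Wgs (Mgs x)) => y ->.
by split; [apply: submodR|move=> x; apply: (submA sE)].
Qed.

Variable c : R.

(* [c] acts invertibly on [U / L], with an inverse induced by a single element of [S]. *)
Definition cinv (L U : M -> Prop) : Prop :=
  exists u, forall x, U x -> L (x - act x (io c * u)).

Lemma cinv_trans L W U : cinv L W -> cinv W U -> cinv L U.
Proof.
move=> [u2 H2] [u1 H1]; exists (u2 + u1 - u1 * io c * u2) => x /H1 /H2.
have actE y u : y - act y (io c * u) = act y (1 - io c * u).
  by rewrite (actBr Mact) (act1 Mact).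
by rewrite !actE (actA Mact) one_subM.
Qed.

Lemma cinv_mono (L L' U U' : M -> Prop) : (forall x, L x -> L' x) ->
  (forall x, U' x -> U x) -> cinv L U -> cinv L' U'.
Proof. by move=> LL UU [u Hu]; exists u => x /UU /Hu /LL. Qed.

(** The inverse of [c] on [U / L] comes from an element of [S], so [S]-submodules allow division by
    [c] there and stationarity up to torsion becomes stationarity. *)
Lemma layer_stationary (L U : M -> Prop) (N : nat -> M -> Prop) :
  submod act L -> submod act U -> tdcc c actR L U -> cinv L U ->
  (forall n, submod act (N n)) -> (forall n x, N n.+1 x -> N n x) ->
  (exists n, forall m x, (n <= m)%N -> N n x -> L x -> N m x) ->
  exists n, forall m x, (n <= m)%N -> N n x -> U x -> N m x.
Proof.
move=> sL sU dLU [u Hu] sN dec.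
apply: (tdcc_stationary actR_rmodule dLU _ _ dec) => [x r|n|n x Ux Hx].
- exact: (submA sU).
- exact: submodR.
have sNL : submod act (sumset (N n) L) by apply: (submod_sum Mact).
apply: (submBr sNL (y := act x (io c * u))).
  by rewrite -(actA Mact); apply: (submA sNL).
exists 0, (x - act x (io c * u)); rewrite add0r; split=> //; last exact: Hu.
exact: (subm0 (sN n)).
Qed.

Section Semilinear.

(** * Fitting's lemma and nilpotent semilinear maps *)

Variables (Y : M -> Prop) (phi : M -> M) (be ga : R -> R).
Hypothesis sY : submod act Y.
Hypothesis phiB : forall x y, phi (x - y) = phi x - phi y.
Hypothesis phiY : forall x, Y x -> Y (phi x).
Hypothesis phiR : forall x r, Y x -> phi (act x (io r)) = act (phi x) (io (be r)).
Hypothesis phith : forall x, Y x -> phi (act x th) = act (phi x) th.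
Hypothesis bega : cancel ga be.

Let iphiB k x y : iter k phi (x - y) = iter k phi x - iter k phi y.
Proof. by elim: k => //= k ->. Qed.

Let iphi0 k : iter k phi 0 = 0.
Proof. by rewrite -(subrr 0) iphiB !subrr. Qed.

Let iphiD k x y : iter k phi (x + y) = iter k phi x + iter k phi y.
Proof. by rewrite -[y in LHS]opprK -[- y]sub0r !iphiB iphi0 sub0r opprK. Qed.

Let iphiY k x : Y x -> Y (iter k phi x).
Proof. by elim: k => //= k IH /IH; apply: phiY. Qed.

Let iphiR k x r : Y x -> iter k phi (act x (io r)) = act (iter k phi x) (io (iter k be r)).
Proof. by move=> Yx; elim: k => //= k ->; rewrite phiR //; apply: iphiY. Qed.

Let iphith k x : Y x -> iter k phi (act x th) = act (iter k phi x) th.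
Proof. by move=> Yx; elim: k => //= k ->; rewrite phith //; apply: iphiY. Qed.

Let ibega k : cancel (iter k ga) (iter k be).
Proof. by elim: k => // k IH r; rewrite iterSr iterS bega IH. Qed.

Let ker k x := Y x /\ iter k phi x = 0.

Let ker_submod k : submod act (ker k).
Proof.
apply: submod_gen => [|x y [Yx Kx] [Yy Ky]|x r [Yx Kx]|x [Yx Kx]].
- by split; [apply: (subm0 sY)|apply: iphi0].
- by split; [apply: (submD sY)|rewrite iphiD Kx Ky addr0].
- by split; [apply: (submA sY)|rewrite iphiR // Kx (act0l Mact)].
by split; [apply: (submA sY)|rewrite iphith // Kx (act0l Mact)].
Qed.

(* Fitting's lemma. *)
Lemma semilinear_nilpotent (E : M -> Prop) : noeth act (fun=> True) ->
  (forall N, submod act N -> (exists x, N x /\ x <> 0) -> exists x, [/\ E x, N x & x <> 0]) ->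
  (forall x, E x -> phi x = 0) ->
  exists k, forall x, Y x -> iter k phi x = 0.
Proof.
move=> acc ess phiE.
have [n x [Yx Kx]|n Hn] := acc ker ker_submod.
  by split=> //; rewrite iterS Kx; apply: (iphi0 1).
exists n => x Yx; apply: NNPP => nx.
(* The image of [phi^n] is a submodule because [be] is onto. If it is nonzero it meets [E] in some
   nonzero [phi^n z]; as [phi] kills [E], [z] lies in [ker n.+1], hence in [ker n]. *)
have [||y [Ey [z [Yz Ez]] ny]] := ess (fun y => exists z, Y z /\ y = iter n phi z).
- apply: submod_gen => [|_ _ [z [Yz ->]] [w [Yw ->]]|_ r [z [Yz ->]]|_ [z [Yz ->]]].
  + by exists 0; split; [apply: (subm0 sY)|rewrite iphi0].
  + by exists (z + w); split; [apply: (submD sY)|rewrite iphiD].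
  + exists (act z (io (iter n ga r))); split; first exact: (submA sY).
    by rewrite iphiR // ibega.
  by exists (act z th); split; [apply: (submA sY)|rewrite iphith].
- by exists (iter n phi x); split=> //; exists x.
apply: ny; rewrite Ez; suff: ker n z by case.
by apply: (Hn n.+1) => //; split=> //; rewrite iterS -Ez phiE.
Qed.

Section Nilpotent.

Variable k : nat.
Hypothesis nilp : forall x, Y x -> iter k phi x = 0.
Hypothesis phic : forall x, Y x -> phi (act x (io c)) = act (phi x) (io c).

Let iphic i x : Y x -> iter i phi (act x (io c)) = act (iter i phi x) (io c).
Proof. by move=> Yx; elim: i => //= i ->; rewrite phic //; apply: iphiY. Qed.

Let kerS i x : ker i.+1 x -> Y (iter i phi x) /\ phi (iter i phi x) = 0.
Proof. by case=> Yx Kx; split=> //; apply: iphiY. Qed.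

(** The map [phi^i] embeds the layer [ker i.+1 / ker i] semilinearly into the kernel of [phi]. *)
Lemma tdcc_nilpotent :
  tdcc c actR (fun x => x = 0) (fun x => Y x /\ phi x = 0) ->
  tdcc c actR (fun x => x = 0) Y.
Proof.
move=> d; suff H i : tdcc c actR (fun x => x = 0) (ker i).
  by apply: tdcc_mono (H k) => // x Yx; split=> //; apply: nilp.
elim: i => [|i IH]; first by apply: tdcc_torsion => x [_ /= ->]; exists 0%N; rewrite (act0l actR_rmodule).
apply: (tdcc_trans actR_rmodule IH).
apply: (@tdcc_transfer _ _ _ _ actR actR _ _ (fun x => x = 0) _
  (iter i phi) (iter i be) (iter i ga)) d => //.
- exact: actR_rmodule.
- exact: actR_rmodule.
- exact: submodR.
- exact: (submod_zero actR_rmodule).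
- by move=> x r [Yx _]; apply: iphiR.
- exact: ibega.
- by move=> x [Yx _]; rewrite /actR iphic ?subrr.
- by move=> x /kerS.
by move=> x [Yx _] Kx.
Qed.

(** Applying [ga] to the coefficients of [s] undoes the twist by [be]. This pulls elements of [S]
    back along [phi]. *)
Lemma semilinear_twist s : exists s', forall x, Y x -> phi (act x s') = act (phi x) s.
Proof.
have [n [r ->]] := skew_gen SE s.
exists (\sum_(i < n) io (ga (r i)) * th ^+ i) => x Yx; rewrite !(act_sumr Mact).
elim/big_rec2: _ => [|i y z _ <-]; first exact: (iphi0 1).
rewrite -[phi _]/(iter 1 phi _) iphiD /=; congr (_ + _).
rewrite -!(actA Mact) -[in RHS](bega (r i)) -phiR //; move: (ga _) => q.
elim: (nat_of_ord i) => [|j IH]; first by rewrite !(act1 Mact).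
rewrite !exprSr -!(actA Mact) phith ?IH //.
by do 2!apply: (submA sY).
Qed.

Lemma cinv_nilpotent :
  cinv (fun x => x = 0) (fun x => Y x /\ phi x = 0) -> cinv (fun x => x = 0) Y.
Proof.
move=> [u Hu]; suff H i : cinv (fun x => x = 0) (ker i).
  by apply: cinv_mono (H k) => // x Yx; split=> //; apply: nilp.
elim: i => [|i IH]; first by exists 0 => x [_ /= ->]; rewrite (act0l Mact) subr0.
apply: (cinv_trans IH).
(* The inverse [u] on the kernel of [phi] is transported to the layer [ker i.+1 / ker i] by twisting
   it [i] times. *)
have [s Hs] : exists s, forall x, Y x -> iter i phi (act x s) = act (iter i phi x) u.
  elim: (i) => [|j [s Hs]]; first by exists u.
  have [s' Hs'] := semilinear_twist s; exists s' => x Yx.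
  by rewrite !iterSr Hs' // Hs //; apply: phiY.
exists s => x Kx; have [Yx _] := Kx; split.
  by apply: (submB Mact sY) => //; apply: (submA sY).
rewrite iphiB -(actA Mact) Hs; last exact: (submA sY).
by rewrite iphic // (actA Mact); apply: Hu; apply: kerS.
Qed.

End Nilpotent.
End Semilinear.
End SkewModule.

End Skew.

(** * Layers annihilated by a stable ideal *)

Section Layers.

Variables (R : comNzRingType) (S : nzRingType) (io : {rmorphism R -> S}).
Variables (al : {rmorphism R -> R}) (ali : R -> R) (th : S).
Hypothesis SE : skew_ext io al ali th.
Variables (M : zmodType) (act : M -> S -> M) (P : R -> Prop) (c : R).
Hypothesis Mact : rmodule act.
Hypothesis PI : submod *%R P.
Hypothesis Pal : forall p, P p -> P (al p).
Hypothesis Pc : P (al c - c).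

Lemma invariant_iter d n : P (al d - d) -> P (iter n al d - d).
Proof.
move=> Pd; elim: n => [|n IH]; first by rewrite subrr; apply: (subm0 PI).
by rewrite iterS -(subrK (al d) (al _)) -addrA -rmorphB; apply: (submD PI) => //; apply: Pal.
Qed.

Lemma invariant_exp n : P (al (c ^+ n) - c ^+ n).
Proof. by rewrite rmorphXn subrXX; apply: (submA PI). Qed.

(** Moving [d] past [th^i] replaces it by [iter i al d], which differs from [d] by an element of
    [P]. *)
Lemma invariant_central (L U : M -> Prop) d x s :
  P (al d - d) -> submod act L -> submod act U ->
  (forall x p, U x -> P p -> L (act x (io p))) ->
  U x -> L (act x (io d * s) - act x (s * io d)).
Proof.
move=> Pd sL sU ULP Ux; have [n [r ->]] := skew_gen SE s.
rewrite mulr_sumr mulr_suml -(actBr Mact) -sumrB (act_sumr Mact).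
apply: (subm_sum sL) => i.
have -> : io d * (io (r i) * th ^+ i) - io (r i) * th ^+ i * io d =
    io (r i) * io (d - iter i al d) * th ^+ i.
  rewrite -(mulrA _ _ (io d)) (thnR SE) !mulrA -!rmorphM (mulrC d).
  by rewrite mulrBr rmorphB mulrBl.
rewrite -!(actA Mact); apply: (submA sL); apply: ULP; first exact: (submA sU).
by rewrite -opprB; apply: (submN (@regular_rmodule R) PI); apply: invariant_iter.
Qed.

Section Step.

Variables L W U : M -> Prop.
Hypothesis sL : submod act L.
Hypothesis sW : submod act W.
Hypothesis sU : submod act U.
Hypothesis UP : forall x p, U x -> P p -> W (act x (io p)).
Hypothesis WP : forall x p, W x -> P p -> L (act x (io p)).
Hypothesis LW : forall x, U x -> (forall p, P p -> L (act x (io p))) -> W x.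

(** Congruence modulo [J] compares elements of [S] by the maps that they induce from [U] to
    [M / L]. *)
Let J y := forall x, U x -> L (act x y).

Let J0 : J 0. Proof. by move=> x _; rewrite (act0r Mact); apply: (subm0 sL). Qed.

Let JD y z : J y -> J z -> J (y + z).
Proof. by move=> Jy Jz x Ux; rewrite (actDr Mact); apply: (submD sL); [apply: Jy|apply: Jz]. Qed.

Let JM s y : J y -> J (s * y).
Proof. by move=> Jy x Ux; rewrite -(actA Mact); apply: Jy; apply: (submA sU). Qed.

Let JN y : J y -> J (- y).
Proof. by rewrite -mulN1r; apply: JM. Qed.

Let eqJ y z := J (y - z).

Let eqJ_trans y z w : eqJ y z -> eqJ z w -> eqJ y w.
Proof. by move=> yz zw; rewrite /eqJ -(subrK z y) -addrA; apply: JD. Qed.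

Let eqJ_sym y z : eqJ y z -> eqJ z y.
Proof. by rewrite /eqJ -(opprB z y) => /JN; rewrite opprK. Qed.

Let eqJM s y z : eqJ y z -> eqJ (s * y) (s * z).
Proof. by rewrite /eqJ -mulrBr; apply: JM. Qed.

(* Right multiplication by [s] inverts [c] on [b S] modulo [J]; since the ascending chain of
   left ideals [S b s^n + J] stabilises, so does left multiplication by some [u]. *)
Let left_inverse b s :
  (forall x, W x -> L (x - act x (io c * s))) ->
  (forall x, U x -> W (act x b)) ->
  (forall x, U x -> L (act x (io c * b) - act x (b * io c))) ->
  (forall x, W x -> L (act x b)) ->
  exists u, J ((1 - io c * u) * b).
Proof.
move=> Hs UbW cb WbL; pose B n := b * s ^+ n.
have UB n x : U x -> W (act x (B n)).
  by move=> Ux; rewrite -(actA Mact); apply: (submA sW); apply: UbW.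
have cB n : eqJ (io c * B n) (B n * io c).
  move=> x Ux; rewrite /B mulrA -(mulrA b) (actBr Mact).
  rewrite -(subrK (act x (b * io c * s ^+ n)) (act x (io c * b * s ^+ n))) -addrA.
  apply: (submD sL).
    by rewrite -!(actA Mact _ _ (s ^+ n)) -(actBl Mact); apply: (submA sL); apply: cb.
  rewrite -mulrA -!(actA Mact x b).
  by apply: (@invariant_central L W) => //; apply: UbW.
have BS n : eqJ (B n) (io c * B n.+1).
  apply: (@eqJ_trans _ (B n * (io c * s))) => [x Ux|].
    by rewrite (actBr Mact) -(actA Mact x (B n)); apply: Hs; apply: UB.
  move=> x Ux; rewrite /B exprSr (mulrA b) !mulrA -mulrBl -(actA Mact).
  by apply: (submA sL); have := eqJ_sym (cB n); rewrite /B !mulrA; apply.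
pose I n y := exists u, eqJ y (u * B n).
have [n|n y [u Hu]|n Hn] := left_noeth SE (N := I).
- split=> [|x y [u Hu] [v Hv]|t x [u Hu]].
  + by exists 0; rewrite /eqJ mul0r subr0.
  + by exists (u + v); rewrite /eqJ mulrDl opprD addrACA; apply: JD.
  by exists (t * u); rewrite -mulrA; apply: eqJM.
- exists (u * io c); apply: eqJ_trans Hu _; rewrite -mulrA; exact: eqJM.
have [|u Hu] := Hn n.+1 (B n.+1) (leqnSn n).
  by exists 1; rewrite mul1r /eqJ subrr.
have bB k : eqJ b (io c ^+ k * B k).
  elim: k => [|k IH]; first by rewrite /B !expr0 mul1r mulr1 /eqJ subrr.
  by apply: eqJ_trans IH _; rewrite exprSr -mulrA; apply: eqJM.
exists u; rewrite mulrBl mul1r; apply: eqJ_trans (bB n) _.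
apply: (@eqJ_trans _ (io c ^+ n * (io c * u * B n))).
  apply: eqJM; apply: eqJ_trans (BS n) _.
  by rewrite -mulrA; apply: eqJM.
apply: (@eqJ_trans _ (io c * u * (io c ^+ n * B n))); last by apply: eqJM; apply: eqJ_sym.
(* The commutator of [c^n] and [c * u] sends [U] into [W] by near centrality of [c], and [b] sends
   [W] into [L]. *)
move=> x Ux; rewrite /B !mulrA -!mulrBl -!(actA Mact _ _ (s ^+ n)) -!(actA Mact _ _ b).
apply: (submA sL); apply: WbL; rewrite -!mulrA (actBr Mact) -rmorphXn (mulrA (io c)).
by apply: (@invariant_central W U) => //; apply: invariant_exp.
Qed.

Variable ps : seq R.
Hypothesis psP : forall p, p \in ps -> P p.
Hypothesis Pps : forall p, P p -> span *%R (fun x => x = 0) ps p.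

Let from_gens x : (forall p, p \in ps -> L (act x (io p))) ->
  forall p, P p -> L (act x (io p)).
Proof.
move=> Hx p /Pps; apply: (@span_min _ _ _ (fun x => x = 0) ps (fun p => L (act x (io p)))).
- split=> [|q r Lq Lr|q r Lq].
  + by rewrite rmorph0 (act0r Mact); apply: (subm0 sL).
  + by rewrite rmorphD (actDr Mact); apply: (submD sL).
  by rewrite rmorphM -(actA Mact); apply: (submA sL).
- by move=> q ->; rewrite rmorph0 (act0r Mact); apply: (subm0 sL).
exact: Hx.
Qed.

(** By [LW] it suffices that every generator [q] of [P] sends [x (1 - c u)] into [L]. The generators
    are treated in turn, with [left_inverse] applied to [(1 - c u) q], and the factors are
    multiplied together. *)
Lemma cinv_step : cinv io act c L W -> cinv io act c W U.
Proof.
move=> [s Hs].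
suff [u Hu] : exists u, forall q, q \in ps -> J ((1 - io c * u) * io q).
  exists u => x Ux; apply: LW.
    by apply: (submB Mact sU) => //; apply: (submA sU).
  apply: from_gens => q /Hu /(_ x Ux).
  by rewrite -(actA Mact x (1 - _)) (actBr Mact) (act1 Mact).
elim: (ps) psP => [|q qs IH] qsP; first by exists 0.
have [|u Hu] := IH; first by move=> p pqs; apply: qsP; rewrite inE pqs orbT.
have Pq : P q by apply: qsP; rewrite mem_head.
have [||||u' Hu'] := @left_inverse ((1 - io c * u) * io q) s.
- exact: Hs.
- by move=> x Ux; rewrite -(actA Mact); apply: UP => //; apply: (submA sU).
- move=> x Ux; rewrite -(mulrA _ (io q)) -rmorphM (mulrC q) rmorphM !mulrA.
  rewrite -!(actA Mact _ _ (io q)) -(actBl Mact); apply: WP => //.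
  exact: (@invariant_central W U).
- by move=> x Wx; rewrite -(actA Mact); apply: WP => //; apply: (submA sW).
exists (u + u' - u' * io c * u); rewrite -one_subM.
move=> p; rewrite -mulrA inE => /orP[/eqP->|/Hu]; last exact: JM.
exact: Hu'.
Qed.

(** Multiplication by the generators of [P] embeds [U / W] into copies of [W / L]; it is [R]-linear
    as [R] is commutative. [K] filters [U] by the generators already dealt with. *)
Lemma tdcc_step : tdcc c (actR io act) L W -> tdcc c (actR io act) W U.
Proof.
have RM := actR_rmodule io Mact.
move=> d; pose K (qs : seq R) x := U x /\ forall q, q \in qs -> L (act x (io q)).
suff H : tdcc c (actR io act) (K ps) U.
  by apply: tdcc_mono H => // x [Ux Kx]; apply: LW => //; apply: from_gens.
have sK qs : submod (actR io act) (K qs).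
  split=> [|x y [Ux Kx] [Uy Ky]|x r [Ux Kx]].
  - by split=> [|q _]; rewrite ?(act0l Mact); [apply: (subm0 sU)|apply: (subm0 sL)].
  - split=> [|q qqs]; first exact: (submD sU).
    by rewrite (actDl Mact); apply: (submD sL); [apply: Kx|apply: Ky].
  split=> [|q qqs]; first exact: (submA sU).
  by rewrite /actR (actRC _ Mact); apply: (submA sL); apply: Kx.
elim: (ps) psP => [|q qs IH] qsP.
  by apply: tdcc_torsion => x Ux; exists 0%N; rewrite expr0 (act1 RM); split.
apply: (tdcc_trans RM) (IH _); last by move=> p pqs; apply: qsP; rewrite inE pqs orbT.
have Pq : P q by apply: qsP; rewrite mem_head.
apply: (@tdcc_transfer _ _ _ _ _ _ _ _ L W (act^~ (io q)) id id RM RM (sK qs)) d => //.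
- exact: submodR.
- by move=> x y; apply: (actBl Mact).
- by move=> x r _; rewrite /actR (actRC _ Mact).
- by move=> x _; rewrite /actR (actRC _ Mact) subrr; apply: (subm0 sL).
- by move=> x [Ux _]; apply: UP.
by move=> x [Ux Kx] Lx; split=> // p; rewrite inE => /orP[/eqP->|/Kx].
Qed.

End Step.

Fixpoint ann_pow (i : nat) (x : M) : Prop :=
  if i is i'.+1 then forall p, P p -> ann_pow i' (act x (io p)) else x = 0.

Lemma ann_pow_submod i : submod act (ann_pow i).
Proof.
elim: i => [|i IH]; first exact: (submod_zero Mact).
apply: (submod_gen SE Mact) => [p Pp|x y Hx Hy p Pp|x r Hx p Pp|x Hx p Pp].
- by rewrite (act0l Mact); apply: (subm0 IH).
- by rewrite (actDl Mact); apply: (submD IH); [apply: Hx|apply: Hy].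
- by rewrite (actRC _ Mact); apply: (submA IH); apply: Hx.
by rewrite (actthR SE Mact); apply: (submA IH); apply: Hx; apply: Pal.
Qed.

Lemma ann_pow_pow i k : (forall x, pow_mod (actR io act) (act^~ th) P (i + k) x -> x = 0) ->
  forall x, pow_mod (actR io act) (act^~ th) P k x -> ann_pow i x.
Proof.
elim: i k => [|i IH] k Hk x Hx; first exact: Hk.
move=> p Pp; apply: (IH k.+1); first by rewrite addnS.
by move=> W sW; apply.
Qed.

Lemma ann_pow_layers k :
  tdcc c (actR io act) (ann_pow 0) (ann_pow 1) -> cinv io act c (ann_pow 0) (ann_pow 1) ->
  tdcc c (actR io act) (ann_pow k) (ann_pow k.+1) /\
  cinv io act c (ann_pow k) (ann_pow k.+1).
Proof.
move=> d1 i1; elim: k => [//|k [IHd IHi]].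
have [|ps [psP Pps]] := @noeth_fg _ _ _ (@regular_rmodule R) P.
  by apply: noethS (skew_noeth SE).
have sub := ann_pow_submod.
have PS i x p : ann_pow i.+1 x -> P p -> ann_pow i (act x (io p)) by move=> Hx /Hx.
split.
  by apply: (tdcc_step (sub k) (sub k.+2) _ _ psP Pps IHd) => [x p|x _]; first exact: PS.
apply: (cinv_step (sub k) (sub k.+1) (sub k.+2) _ _ _ psP Pps IHi) => [x p|x p|x _] //.
  exact: PS.
exact: PS.
Qed.

Lemma ann_pow_artinian k (N : nat -> M -> Prop) :
  tdcc c (actR io act) (ann_pow 0) (ann_pow 1) -> cinv io act c (ann_pow 0) (ann_pow 1) ->
  (forall x, ann_pow k x) ->
  (forall n, submod act (N n)) -> (forall n x, N n.+1 x -> N n x) ->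
  exists n, forall m x, (n <= m)%N -> N n x -> N m x.
Proof.
move=> d1 i1 Mk sN dec.
suff H i : exists n, forall m x, (n <= m)%N -> N n x -> ann_pow i x -> N m x.
  by have [n Hn] := H k; exists n => m x nm Nx; apply: Hn.
elim: i => [|i IH]; first by exists 0%N => m x _ _ ->; apply: (subm0 (sN m)).
have [di ii] := ann_pow_layers i d1 i1.
exact: (layer_stationary Mact (ann_pow_submod i) (ann_pow_submod i.+1) di ii sN dec IH).
Qed.

End Layers.

(** * Simple modules *)

Definition right_dcc (S : nzRingType) (Q : S -> Prop) : Prop :=
  forall N : nat -> S -> Prop,
    (forall k, [/\ N k 0, (forall x y, N k x -> N k y -> N k (x + y)) &
                   (forall x s, N k x -> N k (x * s))]) ->
    (forall k s, Q s -> N k s) -> (forall k s, N k.+1 s -> N k s) ->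
    exists k, forall l s, (k <= l)%N -> N k s -> N l s.

Definition left_dcc (S : nzRingType) (Q : S -> Prop) : Prop :=
  forall N : nat -> S -> Prop,
    (forall k, [/\ N k 0, (forall x y, N k x -> N k y -> N k (x + y)) &
                   (forall x s, N k x -> N k (s * x))]) ->
    (forall k s, Q s -> N k s) -> (forall k s, N k.+1 s -> N k s) ->
    exists k, forall l s, (k <= l)%N -> N k s -> N l s.

Definition module_dcc (S : nzRingType) (M : zmodType) (act : M -> S -> M) : Prop :=
  forall N : nat -> M -> Prop,
    (forall k, submod act (N k)) -> (forall k x, N k.+1 x -> N k x) ->
    exists k, forall l x, (k <= l)%N -> N k x -> N l x.

Definition essential_extension (S : nzRingType) (V M : zmodType) (act : V -> S -> V)
  (actM : M -> S -> M) (f : V -> M) : Prop :=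
  [/\ injective f, (forall v w, f (v + w) = f v + f w),
      (forall v s, f (act v s) = actM (f v) s) &
      (forall N, submod actM N -> (exists x, N x /\ x <> 0) ->
         exists v, v <> 0 /\ N (f v))].

Section Simple.

Variables (R : comNzRingType) (S : nzRingType) (io : {rmorphism R -> S}).
Variables (al : {rmorphism R -> R}) (ali : R -> R) (th : S).
Hypothesis SE : skew_ext io al ali th.
Variables (V : zmodType) (act : V -> S -> V).
Hypothesis Vact : rmodule act.
Hypothesis V0 : exists v : V, v <> 0.
Hypothesis Vs : forall N, submod act N -> (forall x, N x -> x = 0) \/ (forall x, N x).

Let Q s := forall v, act v s = 0.
Let P r := Q (io r).

Lemma annihilator_ideal :
  [/\ Q 0, (forall s t, Q s -> Q t -> Q (s + t)), (forall s t, Q s -> Q (t * s)) &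
      (forall s t, Q s -> Q (s * t))].
Proof.
split=> [v|s t Qs Qt v|s t Qs v|s t Qs v]; first exact: (act0r Vact).
- by rewrite (actDr Vact) Qs Qt addr0.
- by rewrite -(actA Vact) Qs.
by rewrite -(actA Vact) Qs (act0l Vact).
Qed.

Let QD s t : Q s -> Q t -> Q (s + t). Proof. by case: annihilator_ideal => _ + _ _; apply. Qed.
Let QMl s t : Q s -> Q (t * s). Proof. by case: annihilator_ideal => _ _ + _; apply. Qed.
Let QMr s t : Q s -> Q (s * t). Proof. by case: annihilator_ideal => _ _ _ +; apply. Qed.
Let QN s : Q s -> Q (- s). Proof. by rewrite -mulN1r; apply: QMl. Qed.
Let QB s t : Q s -> Q t -> Q (s - t). Proof. by move=> Qs /QN; apply: QD. Qed.

Lemma annihilatorR_ideal : submod *%R P.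
Proof.
split=> [|p q Pp Pq|p r Pp]; rewrite /P.
- by rewrite rmorph0; case: annihilator_ideal.
- by rewrite rmorphD; apply: QD.
by rewrite rmorphM; apply: QMr.
Qed.

Let PI := annihilatorR_ideal.

Lemma simple_cyclic v x : v <> 0 -> exists s, x = act v s.
Proof.
move=> nv; case: (@Vs (fun x => exists s, x = act v s)) => [|H|]; last exact.
  split=> [|_ _ [s ->] [t ->]|_ t [s ->]]; first by exists 0; rewrite (act0r Vact).
    by exists (s + t); rewrite (actDr Vact).
  by exists (s * t); rewrite (actA Vact).
by case: nv; apply: H; exists 1; rewrite (act1 Vact).
Qed.

(** Since [al] is bijective, the kernel and the image of [th] are both submodules of the simple
    module. *)
Lemma theta_dichotomy : (forall v, act v th = 0) \/
  (forall v, act v th = 0 -> v = 0) /\ (forall v, exists w, v = act w th).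
Proof.
case: (@Vs (fun v => act v th = 0)) => [|inj|]; last by left.
  apply: (submod_gen SE Vact) => [|x y Hx Hy|x r Hx|x Hx].
  - exact: (act0l Vact).
  - by rewrite (actDl Vact) Hx Hy addr0.
  - by rewrite (actRth SE Vact) Hx (act0l Vact).
  by rewrite Hx (act0l Vact).
case: (@Vs (fun v => exists w, v = act w th)) => [|H|]; last by right.
  apply: (submod_gen SE Vact) => [|_ _ [w ->] [z ->]|_ r [w ->]|_ [w ->]].
  - by exists 0; rewrite (act0l Vact).
  - by exists (w + z); rewrite (actDl Vact).
  - by exists (act w (io (al r))); rewrite (actthR SE Vact).
  by exists (act w th).
by left=> v; apply: H; exists v.
Qed.

(** * The case where [th] acts as zero on [V] *)

Section ThetaZero.

Hypothesis Vth : forall v, act v th = 0.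

(** Where [th] acts as zero, [s] acts through its constant coefficient. That coefficient is chosen
    before the module, as it serves both [V] and submodules of an extension. *)
Let const_act s : exists b, forall (M : zmodType) (actM : M -> S -> M) (Y : M -> Prop),
  rmodule actM -> submod actM Y -> (forall x, Y x -> actM x th = 0) ->
  forall x, Y x -> actM x s = actM x (io b).
Proof.
have [[|k] [r ->]] := skew_gen SE s.
  by exists 0 => M actM Y Mact _ _ x _; rewrite big_ord0 rmorph0.
exists (r 0%N) => M actM Y Mact sY Yth x Yx.
rewrite big_ord_recl mulr1 (actDr Mact) (act_sumr Mact) big1 ?addr0 // => i _.
rewrite exprS -!(actA Mact) Yth ?(act0l Mact) //.
exact: (submA sY).
Qed.

Let constV s : exists b, Q (s - io b).
Proof.
have [b Hb] := const_act s; exists b => v.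
by rewrite (actBr Vact) (Hb V act (fun=> True)) ?subrr //; apply: submod_full.
Qed.

(** If [v b] is nonzero, simplicity brings it back to [v] by some [s], hence by a constant [d]. Then
    [1 - b d] kills [v], and so kills [V], which is [v R]. *)
Let P_maximal b : ~ P b -> exists d, P (1 - b * d).
Proof.
move=> nPb; have [v nv] : exists v, act v (io b) <> 0.
  by apply: NNPP => H; apply: nPb => v; apply: NNPP => nv; apply: H; exists v.
have [s Es] := simple_cyclic v nv; have [d Qd] := constV s.
have Ed : act v (io (1 - b * d)) = 0.
  rewrite rmorphB rmorph1 (actBr Vact) (act1 Vact) rmorphM -(actA Vact) {1}Es.
  by rewrite -(actBr Vact) Qd.
exists d => x; have nv0 : v <> 0 by move=> v0; apply: nv; rewrite v0 (act0l Vact).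
have [t ->] := simple_cyclic x nv0; have [e Qe] := constV t.
have /eqP := Qe v; rewrite (actBr Vact) subr_eq0 => /eqP ->.
by rewrite (actRC _ Vact) Ed (act0l Vact).
Qed.

(** [S / Q] is the field [R / P], so a term of the chain is [Q] or everything. Only closure under
    multiplication of constants is assumed, which covers both left and right ideals. *)
Let chain_zero (N : nat -> S -> Prop) :
  (forall k x y, N k x -> N k y -> N k (x + y)) ->
  (forall k b d, N k (io b) -> N k (io (b * d))) ->
  (forall k s, N k 1 -> N k s) ->
  (forall k s, Q s -> N k s) -> (forall k s, N k.+1 s -> N k s) ->
  exists k, forall l s, (k <= l)%N -> N k s -> N l s.
Proof.
move=> ND NM N1 QN' dec.
case: (classic (exists k, forall s, N k s -> Q s)) => [[k Hk]|H].
  by exists k => l s _ /Hk; apply: QN'.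
exists 0%N => l s _ _; apply: (N1).
have [t [Nt nQt]] : exists t, N l t /\ ~ Q t.
  apply: NNPP => H'; apply: H; exists l => t Nt; apply: NNPP => nQt.
  by apply: H'; exists t.
have [b Qb] := constV t.
have Nb : N l (io b).
  by rewrite -(subrK t (io b)) -opprB; apply: (ND) => //; apply: QN'; apply: QN.
have nPb : ~ P b by move=> Pb; apply: nQt; rewrite -(subrK (io b) t); apply: QD.
have [d Pd] := P_maximal nPb.
rewrite -(subrK (io (b * d)) 1); apply: (ND); last exact: NM.
by apply: QN'; rewrite -(rmorph1 io) -rmorphB.
Qed.

Let right_zero : right_dcc Q.
Proof.
move=> N sN QN' dec; apply: chain_zero => // [k|k b d Nb|k s N1].
- by case: (sN k).
- by rewrite rmorphM; case: (sN k) => _ _; apply.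
by rewrite -[s]mul1r; case: (sN k) => _ _; apply.
Qed.

Let left_zero : left_dcc Q.
Proof.
move=> N sN QN' dec; apply: chain_zero => // [k|k b d Nb|k s N1].
- by case: (sN k).
- by rewrite mulrC rmorphM; case: (sN k) => _ _; apply.
by rewrite -[s]mulr1; case: (sN k) => _ _; apply.
Qed.

(** For [c = 1] nothing is torsion and [tdcc] is the ordinary descending chain condition. *)
Let tdcc_zero : tdcc 1 *%R P (fun=> True).
Proof.
apply: (@tdcc_cmaximal _ 1 P (fun=> P) 1) => [i _|b Pb]; last exact: (Pb 0%N).
split=> // b /P_maximal [d Pd]; by exists 0%N, d.
Qed.

(** * Essential extensions when [th] acts as zero *)

Section Extension.

Variables (M : zmodType) (actM : M -> S -> M) (f : V -> M) (gs : seq M).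
Hypothesis Mact : rmodule actM.
Hypothesis Mgs : forall x, span actM (fun x => x = 0) gs x.
Hypothesis fext : essential_extension act actM f.

Let E x := exists v, x = f v.

Let f0 : f 0 = 0.
Proof. by case: fext => _ fD _ _; apply: (addrI (f 0)); rewrite -fD !addr0. Qed.

Let EQ x s : E x -> Q s -> actM x s = 0.
Proof. by have [_ _ fA _] := fext; move=> [v ->] Qs; rewrite -fA Qs f0. Qed.

Let ess N : submod actM N -> (exists x, N x /\ x <> 0) -> exists x, [/\ E x, N x & x <> 0].
Proof.
have [fI _ _ fe] := fext; move=> sN /(fe _ sN) [v [nv Nv]]; exists (f v).
by split=> //; [exists v|rewrite -f0 => /fI].
Qed.

Let noethM : noeth actM (fun=> True).
Proof. exact: (skew_module_noeth SE Mact Mgs). Qed.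

Let aM := actR io actM.
Let MR : rmodule aM := actR_rmodule io Mact.

Let Y (qs : seq R) x := actM x th = 0 /\ forall q, q \in qs -> actM x (io q) = 0.

Let sY qs : submod actM (Y qs).
Proof.
apply: (submod_gen SE Mact) => [|x y [tx Hx] [ty Hy]|x r [tx Hx]|x [tx Hx]].
- by split=> [|q _]; rewrite (act0l Mact).
- by split=> [|q qqs]; rewrite (actDl Mact) ?tx ?ty ?Hx ?Hy ?addr0.
- split=> [|q qqs]; first by rewrite (actRth SE Mact) tx (act0l Mact).
  by rewrite (actRC _ Mact) Hx // (act0l Mact).
by rewrite tx; split=> [|q _]; rewrite (act0l Mact).
Qed.

(** Each [q] in [P] kills the essential submodule [E], so Fitting's lemma makes it nilpotent; the
    condition then passes from the kernel of [q] to the whole. *)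
Let tdcc_drop qs1 qs2 : (forall q, q \in qs1 -> P q) ->
  tdcc 1 aM (fun x => x = 0) (Y (qs1 ++ qs2)) -> tdcc 1 aM (fun x => x = 0) (Y qs2).
Proof.
elim: qs1 => //= q qs IH Pqs d.
apply: IH => [p pqs|]; first by apply: Pqs; rewrite inE pqs orbT.
have Pq : P q by apply: Pqs; rewrite mem_head.
pose phi x := actM x (io q).
have sYq := sY (qs ++ qs2).
have phiB x y : phi (x - y) = phi x - phi y by apply: (actBl Mact).
have phiY x : Y (qs ++ qs2) x -> Y (qs ++ qs2) (phi x) by apply: (submA sYq).
have phiR x b : Y (qs ++ qs2) x -> phi (actM x (io b)) = actM (phi x) (io (id b)).
  by move=> _; rewrite /phi (actRC _ Mact).
(* Both sides vanish on the kernel of [th]; elsewhere [q] would not commute with [th]. *)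
have phith x : Y (qs ++ qs2) x -> phi (actM x th) = actM (phi x) th.
  by move=> [tx _]; rewrite /phi (actRth SE Mact) tx !(act0l Mact).
have idK : cancel (@id R) id by [].
have [k Hk] := semilinear_nilpotent SE Mact sYq phiB phiY phiR phith idK noethM ess
  (fun x Ex => EQ Ex Pq).
apply: (tdcc_nilpotent SE Mact sYq phiB phiY phiR phith idK Hk).
  by move=> x Yx; rewrite phiR.
apply: tdcc_mono d => // x [[tx Hx] px]; split=> // p; rewrite inE => /orP[/eqP->//|].
exact: Hx.
Qed.

(** The elements of the kernel of [th] killed by [P] are finitely generated over [S], which acts
    through constants, so they form a finite-dimensional space over [R / P]. [tdcc_drop] then
    removes the generators of [P]. *)
Let tdcc_ker : tdcc 1 aM (fun x => x = 0) (Y [::]).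
Proof.
have [|ps [psP Pps]] := @noeth_fg _ _ _ (@regular_rmodule R) P.
  by apply: noethS (skew_noeth SE).
apply: (tdcc_drop (qs1 := ps)) => //; rewrite cats0.
have [hs [hsY Yhs]] : exists hs, (forall g, g \in hs -> Y ps g) /\
    forall x, Y ps x -> span actM (fun x => x = 0) hs x.
  by apply: (noeth_fg Mact); apply: noethS noethM.
have s0 := submod_zero MR.
apply: (tdcc_span MR (gs := hs) tdcc_zero s0) => [g p /hsY [_ Hg] /Pps|x Yx].
  apply: (@span_min _ _ _ (fun x => x = 0) ps (fun p => aM g p = 0)) => //.
    split=> [|q r Hq Hr|q r Hq]; first exact: (act0r MR).
      by rewrite (actDr MR) Hq Hr addr0.
    by rewrite -(actA MR) Hq (act0l MR).
  by move=> q ->; apply: (act0r MR).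
exists 0%N; rewrite expr0 (act1 MR).
move: (Yhs x Yx) => {Yx Yhs}; elim: hs hsY x => [|h hs IH] hsY x //= [s Hs].
have [b Hb] := const_act s; exists b.
rewrite /aM /actR -(Hb M actM (Y ps)) => //.
- by apply: IH Hs => g ghs; apply: hsY; rewrite inE ghs orbT.
- by move=> y [].
by apply: hsY; rewrite mem_head.
Qed.

Lemma zero_extension : module_dcc actM.
Proof.
pose phi x := actM x th.
have phiB x y : phi (x - y) = phi x - phi y by apply: (actBl Mact).
have phiR x b : True -> phi (actM x (io b)) = actM (phi x) (io (ali b)).
  by move=> _; rewrite /phi (actRth SE Mact).
have [//|//|k Hk] := @semilinear_nilpotent _ _ _ _ _ _ SE _ _ Mact (fun=> True) phi ali al
  (submod_full actM) phiB _ phiR _ (alK SE) E noethM ess (fun x Ex => EQ Ex Vth).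
have d : tdcc 1 aM (fun x => x = 0) (fun=> True).
  apply: (tdcc_nilpotent SE Mact (submod_full actM) phiB _ phiR _ (alK SE) Hk) => //.
    by move=> x _; rewrite rmorph1 !(act1 Mact).
  by apply: tdcc_mono tdcc_ker => // x [_ tx].
move=> N sN dec.
have [||||k' Hk'] := layer_stationary Mact (N := N) (submod_zero Mact) (submod_full actM) d.
- by exists 1 => x _; rewrite rmorph1 mulr1 (act1 Mact) subrr.
- exact: sN.
- exact: dec.
- by exists 0%N => m x _ _ ->; apply: (subm0 (sN m)).
by exists k' => m x km Nx; apply: Hk'.
Qed.

End Extension.

Theorem zero_case : [/\ right_dcc Q, left_dcc Q &
  forall (M : zmodType) (actM : M -> S -> M) (f : V -> M) gs, rmodule actM ->
    (forall x, span actM (fun x => x = 0) gs x) -> essential_extension act actM f ->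
    module_dcc actM].
Proof. by split=> // M actM f gs; apply: zero_extension. Qed.

End ThetaZero.

(** * The case where [th] acts bijectively on [V] *)

Hypothesis thI : forall v, act v th = 0 -> v = 0.
Hypothesis thS : forall v, exists w, v = act w th.

Lemma annR_al p : P p -> P (al p).
Proof. by move=> Pp v; apply: thI; rewrite -(actthR SE Vact). Qed.

Lemma annR_ali p : P p -> P (ali p).
Proof.
move=> Pp v; have [w ->] := thS v.
by rewrite -(actRth SE Vact) Pp (act0l Vact).
Qed.

Let annR_iter_ali n p : P (iter n al p) -> P p.
Proof.
elim: n => //= n IH /annR_ali; rewrite (alK SE); exact: IH.
Qed.

(** [V I] is a nonzero submodule, hence [V]. Only additivity is asked of [W], which in the uses need
    not be an [S]-submodule. *)
Lemma ideal_full (I : R -> Prop) (W : V -> Prop) :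
  submod *%R I -> (forall r, I r -> I (ali r)) -> (exists r, I r /\ ~ P r) ->
  W 0 -> (forall x y, W x -> W y -> W (x + y)) ->
  (forall v r, I r -> W (act v (io r))) -> forall x, W x.
Proof.
move=> sI Iali [r [Ir nPr]] W0 WD WI.
pose VI x := forall W : V -> Prop, W 0 -> (forall x y, W x -> W y -> W (x + y)) ->
  (forall v r, I r -> W (act v (io r))) -> W x.
case: (@Vs VI) => [|H|H x]; last exact: H.
- apply: (submod_gen SE Vact) => [Z //|x y Hx Hy Z Z0 ZD ZI|x s Hx Z Z0 ZD ZI|x Hx Z Z0 ZD ZI].
  + exact: (ZD _ _ (Hx Z Z0 ZD ZI) (Hy Z Z0 ZD ZI)).
  + apply: (Hx (fun y => Z (act y (io s)))) => [|y z Zy Zz|v q Iq].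
    * by rewrite (act0l Vact).
    * by rewrite (actDl Vact); apply: ZD.
    by rewrite (actA Vact) -rmorphM; apply: ZI; apply: (submA sI).
  apply: (Hx (fun y => Z (act y th))) => [|y z Zy Zz|v q Iq].
  + by rewrite (act0l Vact).
  + by rewrite (actDl Vact); apply: ZD.
  by rewrite (actRth SE Vact); apply: ZI; apply: Iali.
by case: nPr => v; apply: H => Z _ _; apply.
Qed.

(** [V j = (V I) j = 0]. *)
Lemma stable_prime (I : R -> Prop) j :
  submod *%R I -> (forall r, I r -> I (ali r)) -> (exists r, I r /\ ~ P r) ->
  (forall i, I i -> P (i * j)) -> P j.
Proof.
move=> sI Iali nI Ij.
apply: (ideal_full sI Iali nI) => [|x y Hx Hy|v i Ii].
- exact: (act0l Vact).
- by rewrite (actDl Vact) Hx Hy addr0.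
by rewrite (actA Vact) -rmorphM; apply: Ij.
Qed.

Definition pol n (r : nat -> R) := \sum_(i < n) io (r i) * th ^+ i.

Lemma polS n r : pol n.+1 r = pol n r + io (r n) * th ^+ n.
Proof. by rewrite /pol big_ord_recr. Qed.

Lemma polD n r s : pol n r + pol n s = pol n (fun i => r i + s i).
Proof. by rewrite /pol -big_split; apply: eq_bigr => i _; rewrite rmorphD mulrDl. Qed.

Lemma polB n r s : pol n r - pol n s = pol n (fun i => r i - s i).
Proof. by rewrite /pol -sumrB; apply: eq_bigr => i _; rewrite rmorphB mulrBl. Qed.

Lemma polMl n r b : io b * pol n r = pol n (fun i => b * r i).
Proof. by rewrite /pol mulr_sumr; apply: eq_bigr => i _; rewrite rmorphM mulrA. Qed.

Lemma polMr n r b : pol n r * io b = pol n (fun i => r i * iter i al b).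
Proof.
by rewrite /pol mulr_suml; apply: eq_bigr => i _; rewrite -mulrA (thnR SE) mulrA rmorphM.
Qed.

Lemma thpol n r : th * pol n r = pol n (fun i => al (r i)) * th.
Proof.
rewrite /pol mulr_sumr mulr_suml; apply: eq_bigr => i _.
by rewrite mulrA (thR SE) -!mulrA -exprS -exprSr.
Qed.

Let Qpol_al n r : Q (pol n r) -> Q (pol n (fun i => al (r i))).
Proof. by move=> Qr v; apply: thI; rewrite (actA Vact) -thpol -(actA Vact). Qed.

Let Qpol_ali n r : Q (pol n r) -> Q (pol n (fun i => ali (r i))).
Proof.
move=> Qr v; have [w ->] := thS v; rewrite (actA Vact) thpol.
have -> : pol n (fun i => al (ali (r i))) = pol n r.
  by apply: eq_bigr => i _; rewrite (aliK SE).
by rewrite -(actA Vact) Qr (act0l Vact).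
Qed.

Let Qlow n : (forall k, (k < n)%N -> forall r, Q (pol k.+1 r) -> P (r k)) ->
  forall r, Q (pol n r) -> forall i, (i < n)%N -> P (r i).
Proof.
elim: n => // n IH min r Qr i.
have Pn : P (r n) by apply: (min n).
rewrite ltnS leq_eqVlt => /orP[/eqP->//|]; apply: IH.
  by move=> k kn; apply: min; apply: ltnW.
by rewrite -[pol n r](addrK (io (r n) * th ^+ n)) -polS; apply: QB => //; apply: QMr.
Qed.

Hypothesis Qbig : exists n r, Q (pol n r) /\ exists2 i, (i < n)%N & ~ P (r i).

Let min_degree : exists n, (exists r, Q (pol n.+1 r) /\ ~ P (r n)) /\
  forall r, Q (pol n r) -> forall i, (i < n)%N -> P (r i).
Proof.
have [|n [Hn min]] := @exists_least (fun n => exists r, Q (pol n.+1 r) /\ ~ P (r n)).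
  have [n [r [Qr [i ltin nPi]]]] := Qbig; apply: NNPP => H; apply: nPi.
  apply: (Qlow _ Qr) => // k kn q Qq; apply: NNPP => nPk.
  by apply: H; exists k, q.
exists n; split=> //; apply: Qlow => k kn r Qr; apply: NNPP => nPr.
by apply: (min k kn); exists r.
Qed.

(** * Elements of [Q] of minimal degree modulo [P] *)

Section MinimalDegree.

Variable n : nat.
Hypothesis ntop : exists r, Q (pol n.+1 r) /\ ~ P (r n).
Hypothesis nlow : forall r, Q (pol n r) -> forall i, (i < n)%N -> P (r i).

Let coefI i x := exists r, Q (pol n.+1 r) /\ r i = x.

Let coefI_ideal i : submod *%R (coefI i).
Proof.
split=> [|_ _ [r [Qr <-]] [s [Qs <-]]|_ b [r [Qr <-]]].
- exists (fun=> 0); split=> //; rewrite /pol big1 => [|k _]; first by case: annihilator_ideal.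
  by rewrite rmorph0 mul0r.
- by exists (fun i => r i + s i); rewrite -polD; split=> //; apply: QD.
by exists (fun i => b * r i); rewrite -polMl mulrC; split=> //; apply: QMl.
Qed.

Let coefI_ali i x : coefI i x -> coefI i (ali x).
Proof. by case=> r [Qr <-]; exists (fun i => ali (r i)); split=> //; apply: Qpol_ali. Qed.

(** The top coefficients cancel, which brings an element of [Q] below the minimal degree. *)
Let coef_comm r b : Q (pol n.+1 r) ->
  io (iter n al b) * pol n.+1 r - pol n.+1 r * io b =
  pol n (fun i => r i * (iter n al b - iter i al b)).
Proof.
move=> Qr; rewrite polMl polMr polB polS [iter n al b * _]mulrC subrr rmorph0 mul0r addr0.
by apply: eq_bigr => i _; rewrite mulrBr (mulrC (iter n al b)).
Qed.

Let coef_commP r b i : Q (pol n.+1 r) -> (i < n)%N ->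
  P (r i * (iter n al b - iter i al b)).
Proof.
move=> Qr; apply: (nlow (r := fun i => r i * (iter n al b - iter i al b))).
by rewrite -coef_comm //; apply: QB; [apply: QMl|apply: QMr].
Qed.

Let iter_alB k x y : iter k al (x - y) = iter k al x - iter k al y.
Proof. by elim: k => //= k ->; rewrite rmorphB. Qed.

Let iter_al0 k : iter k al 0 = 0.
Proof. by elim: k => //= k ->; rewrite rmorph0. Qed.

Let iter_alD k x y : iter k al (x + y) = iter k al x + iter k al y.
Proof. by elim: k => //= k ->; rewrite rmorphD. Qed.

Let iter_alM k x y : iter k al (x * y) = iter k al x * iter k al y.
Proof. by elim: k => //= k ->; rewrite rmorphM. Qed.

(** For a lower coefficient outside [P], the stable ideal [coefI i] multiplies every
    [al^n b - al^i b] into [P]. Primeness puts these differences in [P], and [al^i] can be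
    cancelled. *)
Lemma finite_order : exists m, (0 < m)%N /\ forall b, P (iter m al b - b).
Proof.
have [r [Qr nPr]] := ntop.
(* Otherwise [r n th^n] alone would lie in [Q], and injectivity of [th] on [V] would put [r n] in
   [P]. *)
have [i [ltin nPi]] : exists i, (i < n)%N /\ ~ P (r i).
  apply: NNPP => H; apply: nPr => v.
  have Plow i : (i < n)%N -> P (r i).
    by move=> ltin; apply: NNPP => nPi; apply: H; exists i.
  have : Q (pol n r).
    by rewrite /pol => w; rewrite (act_sumr Vact) big1 // => i _; apply: QMr; apply: Plow.
  move/(QB Qr)/(_ v); rewrite polS addrC addKr -(actA Vact).
  move: (r n) => q; elim: (n) => [|k IH]; first by rewrite (act1 Vact).
  by rewrite exprSr -(actA Vact) => /thI /IH.
exists (n - i)%N; split=> [|b]; first by rewrite subn_gt0.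
apply: (@annR_iter_ali i); rewrite iter_alB -iterD subnKC; last exact: ltnW.
apply: (@stable_prime (coefI i)) => [|q||_ [q [Qq <-]]].
- exact: coefI_ideal.
- exact: coefI_ali.
- by exists (r i); split=> //; exists r.
exact: coef_commP.
Qed.

Let monic_coefs (I : R -> Prop) (rs : nat -> R) k : submod *%R I -> (forall i, I (rs i)) ->
  forall j, (j < k)%N -> I (\prod_(i < k) ('X - (rs i)%:P))`_j.
Proof.
move=> sI Irs; elim: k => // k IH j ltjk.
rewrite big_ord_recr /= mulrBr coefB coefMX coefMC; apply: (submB (@regular_rmodule R) sI).
  by case: j ltjk => [|j] ltjk /=; [apply: (subm0 sI)|apply: IH].
by rewrite mulrC; apply: (submA sI).
Qed.

(* If all symmetric functions of an orbit in [I] were in [P], then [I] would be nil modulo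
   [P], and an [x] in [I] with maximal annihilator modulo [P] would satisfy [x I <= P]. *)
Lemma invariant_leading_coef :
  exists c r, [/\ ~ P c, P (al c - c), Q (pol n.+1 r) & r n = c].
Proof.
have [m [m0 Pm]] := finite_order.
pose I := coefI n.
have Ial x : I x -> I (al x).
  by case=> r [Qr <-]; exists (fun i => al (r i)); split=> //; apply: Qpol_al.
have sI : submod *%R I by apply: coefI_ideal.
apply: NNPP => noc.
have nil r : I r -> P (r ^+ m).
  move=> Ir; pose f := \prod_(i < m) ('X - (iter i al r)%:P).
  have Iit i : I (iter i al r) by elim: i => //= i; apply: Ial.
  have If j : (j < m)%N -> I f`_j by apply: monic_coefs.
  (* Modulo [P], [al^m] is the identity, so [al] permutes the linear factors of [f] cyclically. *)
  have Pf j : P (al f`_j - f`_j).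
    rewrite -coef_map -coefB; rewrite /f rmorph_prod.
    have -> : \prod_(i < m) map_poly al ('X - (iter i al r)%:P) =
              \prod_(i < m) ('X - (iter i.+1 al r)%:P).
      by apply: eq_bigr => i _; rewrite rmorphB /= map_polyX map_polyC.
    case: (m) (Pm r) m0 => // k Pk _; pose h := \prod_(i < k) ('X - (iter i.+1 al r)%:P).
    have -> : \prod_(i < k.+1) ('X - (iter i.+1 al r)%:P) = h * ('X - (iter k.+1 al r)%:P).
      by rewrite big_ord_recr.
    have -> : \prod_(i < k.+1) ('X - (iter i al r)%:P) = ('X - r%:P) * h.
      by rewrite big_ord_recl; congr (_ * _); apply: eq_bigr.
    rewrite mulrC -mulrBl opprB addrC addrA subrK -polyCB coefCM -opprB mulNr.
    by apply: (submN (@regular_rmodule R) PI); apply: (submA PI).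
  have {Pf}Pf j : (j < m)%N -> P f`_j.
    move=> ltjm; apply: NNPP => nP; apply: noc.
    by have [q [Qq Eq]] := If j ltjm; exists f`_j, q.
  have fr : f.[r] = 0.
    rewrite /f; case: (m) m0 => // k _.
    by rewrite big_ord_recl hornerM hornerXsubC subrr mul0r.
  have szf : size f = m.+1 by rewrite size_prod_XsubC /index_enum -enumT size_enum_ord.
  have monf : f`_m = 1.
    by have /monicP := monic_prod_XsubC (index_enum 'I_m) xpredT (fun i => iter i al r);
      rewrite lead_coefE szf.
  move: fr; rewrite horner_coef szf big_ord_recr /= monf mul1r => /eqP.
  rewrite addrC addr_eq0 => /eqP ->; apply: (submN (@regular_rmodule R) PI).
  by elim/big_rec: _ => [|j x _ Px]; [apply: (subm0 PI)|apply: (submD PI) => //;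
    apply: (submA PI); apply: Pf].
pose an x y := P (x * y).
have [r0 [Qr0 nPr0]] := ntop.
have [||x [[Ix nPx] xmax]] := @exists_maximal R
  (fun x y => (forall z, an x z -> an y z) /\ exists z, an y z /\ ~ an x z)
  (fun x => I x /\ ~ P x) _ (r0 n).
- move=> f Ff; apply: NNPP => H.
  have H' i : (forall z, an (f i) z -> an (f i.+1) z) /\ exists z, an (f i.+1) z /\ ~ an (f i) z.
    by apply: NNPP => Hi; apply: H; exists i.
  have [i|i z|i Hi] := skew_noeth SE (N := fun i => an (f i)).
  + split=> [|y z Hy Hz|y z Hy]; rewrite /an.
    * by rewrite mulr0; apply: (subm0 PI).
    * by rewrite mulrDr; apply: (submD PI).
    by rewrite mulrA; apply: (submA PI).
  + by case: (H' i) => + _; apply.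
  have [_ [z [Hz nHz]]] := H' i; apply: nHz; exact: (Hi i.+1 z (leqnSn i) Logic.I Hz).
- by split=> //; exists r0.
apply: (nPx); apply: (@stable_prime I) => [|r||y Iy]; [exact: sI|exact: coefI_ali| |].
  by exists (r0 n); split=> //; exists r0.
(* For the least power [y^(k+1)] sending [x] into [P], the element [y^k x] is annihilated by [y] and
   by all that annihilates [x]. Maximality then gives [x y] in [P]. *)
have [|k [Pk min]] := @exists_least (fun k => P (y ^+ k * x)).
  by exists m; apply: (submA PI); apply: nil.
case: k Pk min => [|k] Pk min; first by case: nPx; rewrite -[x]mul1r.
have := xmax (y ^+ k * x).
have nPk := min k (leqnn _).
have Ik : I (y ^+ k * x) by rewrite mulrC; apply: (submA sI).
move=> /(_ (conj Ik nPk)) nlt; apply: NNPP => nPyx; apply: nlt; split.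
  by move=> z Hz; rewrite /an -mulrA mulrC; apply: (submA PI).
exists y; split; first by rewrite /an mulrC mulrA -exprS.
by rewrite /an mulrC.
Qed.

(** * The normal element [z] and division by it *)

Section NormalElement.

Variables (m : nat) (c : R) (r : nat -> R).
Hypothesis m0 : (0 < m)%N.
Hypothesis Pm : forall b, P (iter m al b - b).
Hypothesis nPc : ~ P c.
Hypothesis Pc : P (al c - c).
Hypothesis Qz : Q (pol n.+1 r).
Hypothesis rn : r n = c.

Let z := pol n.+1 r.

(* The ideal [P S]. *)
Let PS s := exists k q, s = pol k q /\ forall i, (i < k)%N -> P (q i).

Let killed (M : zmodType) (actM : M -> S -> M) (Y : M -> Prop) :=
  [/\ rmodule actM, submod actM Y & forall x p, Y x -> P p -> actM x (io p) = 0].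

Let killPS (M : zmodType) (actM : M -> S -> M) (Y : M -> Prop) s y :
  killed actM Y -> PS s -> Y y -> actM y s = 0.
Proof.
move=> [Mact sY YP] [k [q [-> Pq]]] Yy; rewrite (act_sumr Mact) big1 // => i _.
by rewrite -(actA Mact) YP ?(act0l Mact) //; apply: Pq.
Qed.

Let zR b : PS (io (iter n al b) * z - z * io b).
Proof.
exists n, (fun i => r i * (iter n al b - iter i al b)).
by split=> [|i ltin]; [apply: coef_comm|apply: coef_commP].
Qed.

(** Applying [al] to the coefficients keeps [z] in [Q]. The difference has its top coefficient in
    [P], so its lower part falls under minimality. Hence [z] commutes with [th] modulo [P S]. *)
Let zthP i : (i < n.+1)%N -> P (al (r i) - r i).
Proof.
rewrite ltnS leq_eqVlt => /orP[/eqP->|]; first by rewrite rn.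
apply: (nlow (r := fun i => al (r i) - r i)).
have Qw : Q (pol n.+1 (fun i => al (r i) - r i)).
  by rewrite -polB; apply: QB => //; apply: Qpol_al.
rewrite -[pol n _](addrK (io (al (r n) - r n) * th ^+ n)) -(polS n (fun i => al (r i) - r i)).
by apply: QB => //; apply: QMr; rewrite rn.
Qed.

Let central (M : zmodType) (actM : M -> S -> M) (Y : M -> Prop) d s y :
  killed actM Y -> P (al d - d) -> Y y -> actM y (io d * s) = actM y (s * io d).
Proof.
move=> [Mact sY YP] Pd Yy; apply/eqP; rewrite -subr_eq0; apply/eqP.
exact: (@invariant_central _ _ _ _ _ _ SE _ _ P Mact PI annR_al (fun x => x = 0) Y d y s
  Pd (submod_zero Mact) sY YP Yy).
Qed.

Let degb d s := exists q, s = pol d q.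

Let degbD d s t : degb d s -> degb d t -> degb d (s + t).
Proof. by move=> [q ->] [q' ->]; exists (fun i => q i + q' i); rewrite polD. Qed.

Let degbB d s t : degb d s -> degb d t -> degb d (s - t).
Proof. by move=> [q ->] [q' ->]; exists (fun i => q i - q' i); rewrite polB. Qed.

Let degb0 d : degb d 0.
Proof.
by exists (fun=> 0); rewrite /pol big1 // => i _; rewrite rmorph0 mul0r.
Qed.

Let degb_term d j b : (j < d)%N -> degb d (io b * th ^+ j).
Proof.
move=> ltjd; exists (fun i => if i == j then b else 0).
rewrite /pol (bigD1 (Ordinal ltjd)) //= eqxx big1 ?addr0 // => i.
by rewrite -val_eqE /= => /negbTE ->; rewrite rmorph0 mul0r.
Qed.

Let degb_sum d k (F : 'I_k -> S) : (forall i, degb d (F i)) -> degb d (\sum_i F i).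
Proof. by move=> dF; elim/big_rec: _ => [|i x _ dx]; [apply: degb0|apply: degbD]. Qed.

Let degb_mono d d' s : (d <= d')%N -> degb d s -> degb d' s.
Proof.
move=> le [q ->]; apply: degb_sum => i; apply: degb_term; exact: leq_trans le.
Qed.

Let divide_step d s : (n <= d)%N -> degb d.+1 s -> exists t s1, io c * s = z * t + s1 /\ degb d s1.
Proof.
(* Moving [b] to the left across [th^d] turns it into [q d], so the leading terms of [c s] and of
   [z th^(d-n) b] agree. *)
move=> nd [q ->]; pose b := iter d ali (q d).
exists (th ^+ (d - n) * io b), (io c * pol d.+1 q - z * (th ^+ (d - n) * io b)).
split; first by rewrite addrC subrK.
rewrite /z !polS rn mulrDr [in X in _ - X]mulrDl.
have -> : io c * (io (q d) * th ^+ d) = io c * th ^+ n * (th ^+ (d - n) * io b).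
  by rewrite -(mulrA (io c)) (mulrA (th ^+ n)) -exprD subnKC // (thnR SE) (iter_aliK SE).
rewrite opprD addrACA subrr addr0; apply: degbB.
  by rewrite polMl; exists (fun i => c * q i).
rewrite /pol mulr_suml; apply: degb_sum => i.
rewrite -mulrA (mulrA (th ^+ i)) -exprD (thnR SE) mulrA -rmorphM; apply: degb_term.
by rewrite -{2}(subnKC nd) ltn_add2r.
Qed.

(** Repeated pseudo-division by [z]. The remainder is found before the module is given, so that a
    fact tested on [V] can be carried over to an extension. *)
Let divide s : exists N s', degb n s' /\
  forall (M : zmodType) (actM : M -> S -> M) (Y : M -> Prop), killed actM Y ->
    (forall x, Y x -> actM x z = 0) ->
    forall y, Y y -> actM y (io (c ^+ N) * s) = actM y s'.
Proof.
have [d [q ->]] := skew_gen SE s.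
suff H : forall d s, degb d s -> exists N s', degb n s' /\
  forall (M : zmodType) (actM : M -> S -> M) (Y : M -> Prop), killed actM Y ->
    (forall x, Y x -> actM x z = 0) ->
    forall y, Y y -> actM y (io (c ^+ N) * s) = actM y s' by apply: (H d); exists q.
elim=> {d q s} [|d IH] s ds.
  by exists 0%N, s; split=> [|*]; [apply: degb_mono ds|rewrite expr0 rmorph1 mul1r].
case: (leqP n d) => [nd|dn]; last first.
  by exists 0%N, s; split=> [|*]; [apply: degb_mono ds|rewrite expr0 rmorph1 mul1r].
have [t [s1 [E ds1]]] := divide_step nd ds; have [N [s' [ds' Hs']]] := IH s1 ds1.
exists N.+1, s'; split=> // M actM Y kY Yz y Yy; have [Mact sY _] := kY.
rewrite -(Hs' M actM Y kY Yz y Yy) exprSr rmorphM -mulrA E -!(actA Mact).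
rewrite (actDr Mact) -(actA Mact _ z) Yz ?(act0l Mact) ?add0r //.
exact: (submA sY).
Qed.

Let killedV : killed act (fun=> True).
Proof. by split=> // x p _; apply. Qed.

Let divideV s : exists N q, Q (io (c ^+ N) * s - pol n q).
Proof.
have [N [s' [[q ->] H]]] := divide s; exists N, q => v.
by rewrite (actBr Vact) (H _ _ _ killedV) ?subrr.
Qed.

Let Pcn k : P (al (c ^+ k) - c ^+ k).
Proof. exact: (invariant_exp PI Pc). Qed.

Let cI v : act v (io c) = 0 -> v = 0.
Proof.
case: (@Vs (fun v => act v (io c) = 0)) => [|H|H]; first 2 last.
- by case: nPc.
- split=> [|x y Hx Hy|x s Hx]; first exact: (act0l Vact).
    by rewrite (actDl Vact) Hx Hy addr0.
  by rewrite (actA Vact) -(central _ killedV) // -(actA Vact) Hx (act0l Vact).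
exact: H.
Qed.

Let cnI k v : act v (io (c ^+ k)) = 0 -> v = 0.
Proof.
elim: k => [|k IH]; first by rewrite expr0 rmorph1 (act1 Vact).
by rewrite exprSr rmorphM -(actA Vact) => /cI.
Qed.

Let aV := actR io act.
Let VR : rmodule aV := actR_rmodule io Vact.
Let spV := span aV (fun x => x = 0).

Let spV_submod gs : submod aV (spV gs).
Proof. by apply: (span_submod VR); apply: (submod_zero VR). Qed.

Let V_fg : exists gs, forall x, exists N, spV gs (aV x (c ^+ N)).
Proof.
have [v nv] := V0; exists [seq act v (th ^+ (i : 'I_n)) | i <- enum 'I_n] => x.
have [s ->] := simple_cyclic x nv; have [N [q Hq]] := divideV s.
exists N; rewrite /aV /actR (actA Vact) -(central s killedV (Pcn N)) //.
have /eqP := Hq v; rewrite (actBr Vact) subr_eq0 => /eqP ->.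
rewrite /pol (act_sumr Vact); apply: (subm_sum (spV_submod _)) => i.
rewrite (Rthn SE) -(actA Vact); apply: (submA (spV_submod _)).
apply: (span_gen VR); first exact: (submod_zero VR).
by apply: map_f; rewrite mem_enum.
Qed.

(** A generating list up to [c]-torsion is shortened until its head is indispensable. The empty list
    fails, as [c] is injective on the nonzero [V]. *)
Let V_top : exists g gs, (forall x, exists N, spV (g :: gs) (aV x (c ^+ N))) /\
  ~ forall x, exists N, spV gs (aV x (c ^+ N)).
Proof.
have [gs] := V_fg; elim: gs => [|g gs IH] Hgs.
  by have [v []] := V0; have [N /cnI] := Hgs v.
by case: (classic (forall x, exists N, spV gs (aV x (c ^+ N)))) => // H; exists g, gs.
Qed.

Let Rm := @regular_rmodule R.

(** After inverting [c], [R / P] embeds into a product of fields [R / mi i], where [mm] is a maximal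
    ideal containing the annihilator of [g] modulo the other generators and the [mi i] are its
    conjugates under [al]. *)
Lemma tdcc_base : tdcc c *%R P (fun=> True).
Proof.
have [g [gs [Hg Hgs]]] := V_top; have ssp := spV_submod gs.
(* The annihilator of [g] modulo the span of [gs], after inverting [c]; it contains no power of [c]
   since [g] is indispensable. *)
pose J b := exists N, spV gs (act g (io (b * c ^+ N))).
have JN j : ~ J (c ^+ j).
  move=> [N HN]; apply: Hgs => x; have [N' [b Hb]] := Hg x.
  exists (N' + (j + N))%N; apply: (submBr ssp (y := aV g (b * c ^+ (j + N)))).
    by rewrite mulrC -(actA VR) exprD; apply: (submA ssp).
  by rewrite exprD -!(actA VR) -(actBl VR); apply: (submA ssp).
have PJ p : P p -> J p.
  by exists 0%N; rewrite mulr1 H; apply: (subm0 ssp).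
pose F I := [/\ submod *%R I, (forall b, J b -> I b) & forall j, ~ I (c ^+ j)].
have [||mm [[smm Jmm cmm] mmax]] := @exists_maximal (R -> Prop)
  (fun I I' => (forall b, I b -> I' b) /\ exists b, I' b /\ ~ I b) F _ J.
- move=> f Ff; apply: NNPP => H.
  have H' i : (forall b, f i b -> f i.+1 b) /\ exists b, f i.+1 b /\ ~ f i b.
    by apply: NNPP => Hi; apply: H; exists i.
  have [i|i b|i Hi] := skew_noeth SE (N := f); first by case: (Ff i).
    by case: (H' i) => + _; apply.
  have [_ [b [Hb nHb]]] := H' i; apply: nHb; exact: (Hi i.+1 b (leqnSn i) Logic.I Hb).
- split=> //; split=> [|x y [N HN] [N' HN']|x b [N HN]].
  + by apply: PJ; apply: (subm0 PI).
  + exists (N + N')%N; rewrite mulrDl rmorphD (actDr Vact); apply: (submD ssp).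
      by rewrite exprD mulrA -[act _ _]/(aV _ _) -(actA VR); apply: (submA ssp).
    by rewrite addnC exprD mulrA -[act _ _]/(aV _ _) -(actA VR); apply: (submA ssp).
  by exists N; rewrite mulrAC -[act _ _]/(aV _ _) -(actA VR); apply: (submA ssp).
have Pmm p : P p -> mm p by move=> /PJ /Jmm.
have mm_max : cmaximal c mm.
  split=> // b nb; apply: NNPP => H.
  apply: (mmax (sumset mm (fun x => exists d, x = b * d))).
    split=> [|x Jx|j [x [_ [mx [d ->] E]]]].
    - apply: (submod_sum Rm) => //; split=> [|_ _ [d ->] [e ->]|_ e [d ->]].
      + by exists 0; rewrite mulr0.
      + by exists (d + e); rewrite mulrDr.
      by exists (d * e); rewrite mulrA.
    - by exists x, 0; split; rewrite ?addr0; [apply: Jmm|exists 0; rewrite mulr0|].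
    by apply: H; exists j, d; rewrite E addrK.
  split=> [x mx|]; first by exists x, 0; split; rewrite ?addr0 //; exists 0; rewrite mulr0.
  exists b; split=> //; exists 0, b; split; rewrite ?add0r //; first exact: (subm0 smm).
  by exists 1; rewrite mulr1.
pose mi i b := mm (iter i al b).
apply: (@tdcc_cmaximal _ c P mi m) => [i _|].
  split=> [|b nb].
    split=> [|x y Hx Hy|x y Hx]; rewrite /mi.
    - by rewrite iter_al0; apply: (subm0 smm).
    - by rewrite iter_alD; apply: (submD smm).
    by rewrite iter_alM; apply: (submA smm).
  have [_ /(_ _ nb) [N [d Hd]]] := mm_max; exists N, (iter i ali d).
  rewrite /mi iter_alB iter_alM (iter_aliK SE).
  apply: (submBr smm (y := c ^+ N - iter i al b * d)) => //.
  rewrite opprB addrA subrK; apply: Pmm.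
  by apply: (invariant_iter PI annR_al); apply: Pcn.
move=> b Ib; apply: NNPP => nPb.
pose I x := forall i, (i < m)%N -> mi i x.
(* The localised subgroup [g mm + span gs]. If the stable intersection [I] were not inside [P], then
   [V = V I] would lie in [W], and [g] in [W] would force a power of [c] into [mm]. *)
pose W x := exists N d, mm d /\ spV gs (aV x (c ^+ N) - aV g d).
have [] : W g; last first.
  move=> N [d [md Hd]]; apply: (cmm N); apply: (submBr smm (y := d)) => //.
  apply: Jmm; exists 0%N; rewrite mulr1.
  by move: Hd; rewrite -(actBr VR).
apply: (@ideal_full I W).
- split=> [i _|x y Hx Hy i ltim|x y Hx i ltim].
  + by rewrite /mi iter_al0; apply: (subm0 smm).
  + by rewrite /mi iter_alD; apply: (submD smm); [apply: Hx|apply: Hy].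
  by rewrite /mi iter_alM; apply: (submA smm); apply: Hx.
(* Stability of the intersection: for index 0, [al^m] being the identity modulo [P] leads back to
   index [m - 1]. *)
- move=> x Ix [_|i ltim]; rewrite /mi; last first.
    by rewrite iterSr (aliK SE); apply: Ix; apply: ltnW.
  apply: (submBr smm (y := - (iter m al (ali x) - ali x))).
    by apply: Pmm; apply: (submN Rm PI); apply: Pm.
  rewrite opprK addrC subrK -(prednK m0) iterSr (aliK SE); apply: Ix.
  by rewrite prednK.
- by exists b.
- exists 0%N, 0; split; first exact: (subm0 smm).
  by rewrite (act0l VR) (act0r VR) subrr; apply: (subm0 ssp).
- move=> x y [N [d [md Hd]]] [N' [d' [md' Hd']]].
  exists (N + N')%N, (d * c ^+ N' + d' * c ^+ N); split.
    by apply: (submD smm); apply: (submA smm).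
  have -> : aV (x + y) (c ^+ (N + N')) - aV g (d * c ^+ N' + d' * c ^+ N) =
      aV (aV x (c ^+ N) - aV g d) (c ^+ N') + aV (aV y (c ^+ N') - aV g d') (c ^+ N).
    rewrite (actDl VR) (actDr VR) !(actBl VR) !(actA VR) -!exprD (addnC N' N).
    by rewrite opprD addrACA.
  by apply: (submD ssp); apply: (submA ssp).
move=> v x Ix; have [N [d Hd]] := Hg v; exists N, (d * x); split.
  by rewrite mulrC; apply: (submA smm); apply: (Ix 0%N).
rewrite /aV /actR (actRC _ Vact) rmorphM -(actA Vact) -(actBl Vact).
exact: (submA ssp x Hd).
Qed.

(** * The Artinian quotient [S / Q] *)

Let gensS := [seq th ^+ (i : 'I_n) | i <- enum 'I_n].

Let gensS_th i : (i < n)%N -> th ^+ i \in gensS.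
Proof. by move=> ltin; apply/mapP; exists (Ordinal ltin); rewrite ?mem_enum. Qed.

Let aSr (x : S) (b : R) := x * io b.
Let aSl (x : S) (b : R) := io b * x.

Let Sr : rmodule aSr.
Proof. by split=> *; rewrite /aSr ?rmorph1 ?rmorphD ?rmorphM ?mulr1 ?mulrDl ?mulrDr ?mulrA. Qed.

Let Sl : rmodule aSl.
Proof.
split=> *; rewrite /aSl ?rmorph1 ?rmorphD ?mul1r ?mulrDl ?mulrDr //.
by rewrite mulrA -rmorphM mulrC.
Qed.

Let QSr : submod aSr Q.
Proof. by case: annihilator_ideal => Q0 _ _ _; split=> // x b; apply: QMr. Qed.

Let QSl : submod aSl Q.
Proof. by case: annihilator_ideal => Q0 _ _ _; split=> // x b; apply: QMl. Qed.

Let Qcentral k s : Q (io (c ^+ k) * s - s * io (c ^+ k)).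
Proof. by move=> v; rewrite (actBr Vact) (central s killedV (Pcn k)) ?subrr. Qed.

Let tdcc_right : tdcc c aSr Q (fun=> True).
Proof.
apply: (tdcc_span Sr (gs := gensS) tdcc_base QSr) => [g p _ Pp|s _].
  by apply: QMl.
have [N [q Hq]] := divideV s; exists N.
have sS := span_submod Sr gensS QSr.
apply: (submBr sS (y := pol n q)).
  apply: (subm_sum sS) => i; rewrite (Rthn SE).
  by apply: (submA sS); apply: (span_gen Sr) => //; apply: gensS_th.
apply: (span_base Sr) => //; rewrite -(subrK (io (c ^+ N) * s) (aSr s _)) -addrA.
by apply: QD => //; rewrite -opprB; apply: QN; apply: Qcentral.
Qed.

Let tdcc_left : tdcc c aSl Q (fun=> True).
Proof.
apply: (tdcc_span Sl (gs := gensS) tdcc_base QSl) => [g p _ Pp|s _].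
  by apply: QMr.
have [N [q Hq]] := divideV s; exists N.
have sS := span_submod Sl gensS QSl.
apply: (submBr sS (y := pol n q)); last exact: (span_base Sl).
apply: (subm_sum sS) => i.
by apply: (submA sS (x := th ^+ i)); apply: (span_gen Sl) => //; apply: gensS_th.
Qed.

(** The annihilators of growing finite families form a descending chain of right [R]-submodules of
    [S]; since [c] is injective on [V], stationarity up to torsion is genuine here. *)
Let V_separated : exists vs : seq V, forall s, (forall v, v \in vs -> act v s = 0) -> Q s.
Proof.
pose an (vs : seq V) s := forall v, v \in vs -> act v s = 0.
have [||vs [_ vmax]] := @exists_maximal (seq V)
  (fun vs vs' => (forall s, an vs' s -> an vs s) /\ exists s, an vs s /\ ~ an vs' s)
  (fun=> True) _ [::] => // [f _|].
  apply: NNPP => H.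
  have H' i : (forall s, an (f i.+1) s -> an (f i) s) /\ exists s, an (f i) s /\ ~ an (f i.+1) s.
    by apply: NNPP => Hi; apply: H; exists i.
  have [i|i s|i Hi] := tdcc_right (N := fun i => an (f i)); last 1 first.
  - have [_ [s [Hs nHs]]] := H' i; apply: nHs.
    have [j [l [Ql Hl]]] := Hi i.+1 s (leqnSn i) Hs Logic.I.
    move=> v vf; apply: (@cnI j); rewrite (actA Vact) -[RHS](Hl v vf) (actBr Vact) Ql.
    by rewrite subr0.
  - split=> [v _|s t Hs Ht v vf|s b Hs v vf]; first exact: (act0r Vact).
      by rewrite (actDr Vact) Hs // Ht // addr0.
    by rewrite -(actA Vact) Hs // (act0l Vact).
  by case: (H' i) => + _; apply.
exists vs => s Hs v; apply: NNPP => nv; apply: (vmax (v :: vs)) => //; split.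
  by move=> t Ht w wvs; apply: Ht; rewrite inE wvs orbT.
by exists s; split=> // H; apply: nv; apply: H; rewrite mem_head.
Qed.

(** It suffices to kill finitely many vectors by [1 - c u]. For a remaining nonzero
    [w = v (1 - c u)], simplicity supplies [t] with [w c t = w], and the two factors are
    multiplied. *)
Lemma inverse_mod_annihilator : exists u, Q (1 - io c * u).
Proof.
have [vs Hvs] := V_separated.
suff [u Hu] : exists u, forall v, v \in vs -> act v (1 - io c * u) = 0.
  by exists u; apply: Hvs.
elim: (vs) => [|v ws [u Hu]]; first by exists 0.
pose w := act v (1 - io c * u).
have [t Ht] : exists t, act w (1 - io c * t) = 0.
  case: (classic (w = 0)) => [->|nw]; first by exists 0; rewrite (act0l Vact).
  have [|t Ht] := @simple_cyclic (act w (io c)) w; first by move/cI.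
  by exists t; rewrite (actBr Vact) (act1 Vact) -(actA Vact) -Ht subrr.
exists (t + u - u * io c * t); rewrite -one_subM.
move=> x; rewrite -(actA Vact) inE => /orP[/eqP->//|/Hu ->].
exact: (act0l Vact).
Qed.

Lemma right_artinian : right_dcc Q.
Proof.
move=> N sN QN' dec; have [u Hu] := inverse_mod_annihilator.
have [|||k s _||k Hk] := tdcc_stationary Sr (U := fun=> True) (N := N) tdcc_right.
- by [].
- by move=> k; have [N0 ND NM] := sN k; split=> // x b; apply: NM.
- exact: dec.
- move=> [x [y [Nx Qy E]]]; exists s, 0; rewrite addr0; split=> //; last exact: (subm0 QSr).
  have [N0 ND NM] := sN k.
  rewrite -(subrK (s * (io c * u)) s); apply: (ND).
    by apply: QN'; rewrite -{1}[s]mulr1 -mulrBr; apply: QMl.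
  rewrite mulrA -[s * io c]/(aSr s c) E; apply: NM; apply: ND => //.
  exact: QN'.
- by exists 0%N => l s _ _; apply: QN'.
by exists k => l s kl Ns; apply: Hk.
Qed.

Lemma left_artinian : left_dcc Q.
Proof.
move=> N sN QN' dec; have [u Hu] := inverse_mod_annihilator.
(* [c] is central modulo [Q], so its right inverse is also a left inverse. *)
have {}Hu : Q (1 - u * io c).
  rewrite -(subrK (io c * u) 1) -addrA; apply: QD => //.
  by have := Qcentral 1 u; rewrite expr1.
have [|||k s _||k Hk] := tdcc_stationary Sl (U := fun=> True) (N := N) tdcc_left.
- by [].
- by move=> k; have [N0 ND NM] := sN k; split=> // x b; apply: NM.
- exact: dec.
- move=> [x [y [Nx Qy E]]]; exists s, 0; rewrite addr0; split=> //; last exact: (subm0 QSl).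
  have [N0 ND NM] := sN k.
  rewrite -(subrK (u * io c * s) s); apply: (ND).
    by apply: QN'; rewrite -{1}[s]mul1r -mulrBl; apply: QMr.
  rewrite -mulrA -[io c * s]/(aSl s c) E; apply: NM; apply: ND => //.
  exact: QN'.
- by exists 0%N => l s _ _; apply: QN'.
by exists k => l s kl Ns; apply: Hk.
Qed.

(** * Essential extensions when [th] is bijective *)

Section Extension.

Variables (M : zmodType) (actM : M -> S -> M) (f : V -> M) (gs : seq M).
Hypothesis Mact : rmodule actM.
Hypothesis Mgs : forall x, span actM (fun x => x = 0) gs x.
Hypothesis fext : essential_extension act actM f.

Let E x := exists v, x = f v.

Let f0 : f 0 = 0.
Proof. by case: fext => _ fD _ _; apply: (addrI (f 0)); rewrite -fD !addr0. Qed.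

Let sE : submod actM E.
Proof.
have [_ fD fA _] := fext; split=> [|_ _ [v ->] [w ->]|_ s [v ->]].
- by exists 0; rewrite f0.
- by exists (v + w).
by exists (act v s).
Qed.

Let EQ x s : E x -> Q s -> actM x s = 0.
Proof. by have [_ _ fA _] := fext; move=> [v ->] Qs; rewrite -fA Qs f0. Qed.

Let EcI x : E x -> actM x (io c) = 0 -> x = 0.
Proof.
have [fI _ fA _] := fext; move=> [v ->]; rewrite -fA -{1}f0 => /fI /cI ->.
exact: f0.
Qed.

Let ess N : submod actM N -> (exists x, N x /\ x <> 0) -> exists x, [/\ E x, N x & x <> 0].
Proof.
have [fI _ _ fe] := fext; move=> sN /(fe _ sN) [v [nv Nv]]; exists (f v).
by split=> //; [exists v|rewrite -f0 => /fI].
Qed.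

Let Y := ann_pow io actM P 1.

Let sY : submod actM Y.
Proof. exact: (ann_pow_submod SE Mact annR_al 1). Qed.

Let killedY : killed actM Y.
Proof. by split=> // x p Yx Pp; apply: Yx. Qed.

Let noethM : noeth actM (fun=> True).
Proof. exact: (skew_module_noeth SE Mact Mgs). Qed.

(** [c] is central on [Y], so its kernel there is a submodule; if nonzero it would meet [E], where
    [c] is injective. *)
Let YcI k x : Y x -> actM x (io (c ^+ k)) = 0 -> x = 0.
Proof.
elim: k x => [|k IH] x Yx; first by rewrite expr0 rmorph1 (act1 Mact).
rewrite exprS rmorphM -(actA Mact) => /IH {}IH.
have {IH} : actM x (io c) = 0 by apply: IH; apply: (submA sY).
move=> xc; apply: NNPP => nx.
have [||e [Ee [_ ec] ne]] := ess (N := fun x => Y x /\ actM x (io c) = 0).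
- split=> [|y w [Yy Hy] [Yw Hw]|y s [Yy Hy]].
  + by split; [apply: (subm0 sY)|rewrite (act0l Mact)].
  + by split; [apply: (submD sY)|rewrite (actDl Mact) Hy Hw addr0].
  split; first exact: (submA sY).
  by rewrite (actA Mact) -(central s killedY Pc) // -(actA Mact) Hy (act0l Mact).
- by exists x.
by apply: ne; apply: EcI.
Qed.

Let phi x := actM x z.
Let be := iter n ali.
Let ga := iter n al.

Let phiB x y : phi (x - y) = phi x - phi y. Proof. exact: (actBl Mact). Qed.
Let phiY x : Y x -> Y (phi x). Proof. exact: (submA sY). Qed.

Let phiR x b : Y x -> phi (actM x (io b)) = actM (phi x) (io (be b)).
Proof.
move=> Yx; rewrite /phi !(actA Mact); apply/eqP; rewrite -subr_eq0 -(actBr Mact).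
by rewrite -{1}(iter_aliK SE n b); apply/eqP; apply: (killPS killedY) => //; apply: zR.
Qed.

Let phith x : Y x -> phi (actM x th) = actM (phi x) th.
Proof.
move=> Yx; rewrite /phi !(actA Mact); apply/eqP; rewrite -subr_eq0 -(actBr Mact).
rewrite thpol -mulrBl polB -(actA Mact) [X in actM X _](killPS killedY) ?(act0l Mact) //.
by exists n.+1, (fun i => al (r i) - r i); split=> // i; apply: zthP.
Qed.

Let bega : cancel ga be. Proof. exact: (iter_alK SE). Qed.

Let phic x : Y x -> phi (actM x (io c)) = actM (phi x) (io c).
Proof. by move=> Yx; rewrite /phi !(actA Mact) (central z killedY Pc). Qed.

Let K x := Y x /\ phi x = 0.

Let sK : submod actM K.
Proof.
apply: (submod_gen SE Mact) => [|x y [Yx Hx] [Yy Hy]|x b [Yx Hx]|x [Yx Hx]].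
- by split; [apply: (subm0 sY)|rewrite /phi (act0l Mact)].
- by split; [apply: (submD sY)|rewrite /phi (actDl Mact) [X in X + _]Hx [X in _ + X]Hy addr0].
- by split; [apply: (submA sY)|rewrite phiR // Hx (act0l Mact)].
by split; [apply: (submA sY)|rewrite phith // Hx (act0l Mact)].
Qed.

Let killedK : killed actM K.
Proof. by split=> // x p [Yx _] Pp; apply: Yx. Qed.

Let divideK s : exists N q, forall x, K x -> actM x (s * io (c ^+ N)) = actM x (pol n q).
Proof.
have [N [s' [[q ->] H]]] := divide s; exists N, q => x Kx.
by rewrite -(central s killedK (Pcn N)) // (H _ _ _ killedK) // => y [].
Qed.

(** The remainder of [s] lies in [Q], as is seen on [V]. Its degree is below the minimal one, so its
    coefficients are in [P] and it kills [K]; a power of [c] is then cancelled. *)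
Let KQ x s : K x -> Q s -> actM x s = 0.
Proof.
move=> Kx Qs; have [N [s' [[q ->] H]]] := divide s.
have Qq : Q (pol n q).
  by move=> v; rewrite -(H _ _ _ killedV) //; apply: QMl.
apply: (@YcI N); first by apply: (submA sY); case: Kx.
rewrite (actA Mact) -(central s killedK (Pcn N)) // (H _ _ _ killedK) //; last by move=> y [].
by apply: (killPS killedK) => //; exists n, q; split=> //; apply: nlow.
Qed.

Let aM := actR io actM.
Let MR : rmodule aM := actR_rmodule io Mact.

Let tdccK : tdcc c aM (fun x => x = 0) K.
Proof.
have [hs [hsK Khs]] : exists hs, (forall g, g \in hs -> K g) /\
    forall x, K x -> span actM (fun x => x = 0) hs x.
  by apply: (noeth_fg Mact); apply: noethS noethM.
pose gens := [seq actM h (th ^+ (i : 'I_n)) | h <- hs, i <- enum 'I_n].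
have s0 := submod_zero MR.
have sS := span_submod MR gens s0.
apply: (tdcc_span MR (gs := gens) tdcc_base s0) => [g p|x Kx].
  move=> /allpairsP [[h i] [/= hhs _ ->]] Pp.
  by case: killedK => _ _; apply=> //; apply: (submA sK); apply: hsK.
suff H ks : {subset ks <= hs} -> forall x, span actM (fun x => x = 0) ks x ->
    exists j, span aM (fun x => x = 0) gens (aM x (c ^+ j)).
  by apply: (H hs) => //; apply: Khs.
elim: ks {x Kx} => [|h ks IH] sub x /=.
  by move=> ->; exists 0%N; rewrite (act0l MR); apply: (subm0 sS).
move=> [s Hs].
have [|N HN] := IH _ _ Hs; first by move=> k kks; apply: sub; rewrite inE kks orbT.
have [N' [q Hq]] := divideK s.
have hhs : h \in hs by apply: sub; rewrite mem_head.
exists (N + N')%N; rewrite -(subrK (actM h s) x) (actDl MR); apply: (submD sS).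
  by rewrite exprD -(actA MR); apply: (submA sS).
rewrite addnC exprD -(actA MR); apply: (submA sS).
rewrite /aM /actR (actA Mact) Hq; last exact: hsK.
rewrite /pol (act_sumr Mact); apply: (subm_sum sS) => i.
rewrite (Rthn SE) -(actA Mact); apply: (submA sS); apply: (span_gen MR) => //.
by apply/allpairsP; exists (h, i); rewrite mem_enum.
Qed.

Lemma extension_artinian : module_dcc actM.
Proof.
have [k Hk] : exists k, forall x, Y x -> iter k phi x = 0.
  apply: (semilinear_nilpotent SE Mact sY phiB phiY phiR phith bega noethM ess).
  by move=> x Ex; apply: EQ.
have d1 := tdcc_nilpotent SE Mact sY phiB phiY phiR phith bega Hk phic tdccK.
have i1 : cinv io actM c (fun x => x = 0) Y.
  apply: (cinv_nilpotent SE Mact sY phiB phiY phiR phith bega Hk phic).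
  have [u Qu] := inverse_mod_annihilator; exists u => x Kx.
  by rewrite -{1}(act1 Mact x) -(actBr Mact); apply: KQ.
have [j Hj] : exists j, forall x, E x -> pow_mod aM (actM^~ th) P j x -> x = 0.
  apply: (skew_module_artin_rees SE Mact Mgs PI annR_al annR_ali sE).
  by move=> x p Ex Pp; apply: EQ.
move=> N sN dec; apply: (ann_pow_artinian SE Mact PI annR_al Pc (k := j) d1 i1) => // x.
(* A nonzero [M P^j] would contain a nonzero element of [E], against Artin-Rees. So [M] is
   annihilated by [P^j]. *)
apply: (@ann_pow_pow _ _ _ th _ _ P _ 0) => // y; rewrite addn0 => Hy.
apply: NNPP => ny; have [||w [Ew Hw nw]] := ess (N := pow_mod aM (actM^~ th) P j).
- by have [[W0 WD WR] WT] := pow_mod_stable aM (actM^~ th) P j; apply: (submod_gen SE Mact).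
- by exists y.
by apply: nw; apply: Hj.
Qed.

End Extension.
End NormalElement.

End MinimalDegree.

Theorem invertible_case : [/\ right_dcc Q, left_dcc Q &
  forall (M : zmodType) (actM : M -> S -> M) (f : V -> M) gs, rmodule actM ->
    (forall x, span actM (fun x => x = 0) gs x) -> essential_extension act actM f ->
    module_dcc actM].
Proof.
have [n [ntop nlow]] := min_degree.
have [m [m0 Pm]] := finite_order ntop nlow.
have [c [r [nPc Pc Qz rn]]] := invariant_leading_coef ntop nlow.
split.
- exact: (right_artinian m0 Pm nPc Pc Qz rn).
- exact: (left_artinian m0 Pm nPc Pc Qz rn).
move=> M actM f gs; exact: (extension_artinian nlow m0 Pm nPc Pc Qz rn).
Qed.

End Simple.

(** * The skew polynomial ring *)

Section SkewMul.

Variables (R : comNzRingType) (a : {rmorphism R -> R}).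
Implicit Types p q r : {poly R}.

(* Left multiplication by [theta]. *)
Definition shift q : {poly R} := 'X * map_poly a q.

Lemma shiftD q r : shift (q + r) = shift q + shift r.
Proof. by rewrite /shift rmorphD mulrDr. Qed.

Lemma shift_iterD i q r : iter i shift (q + r) = iter i shift q + iter i shift r.
Proof. by elim: i => //= i ->; rewrite shiftD. Qed.

Lemma shiftZ b q : shift (b *: q) = a b *: shift q.
Proof. by rewrite /shift map_polyZ scalerAr. Qed.

Lemma shift0 : shift 0 = 0.
Proof. by rewrite /shift rmorph0 mulr0. Qed.

Lemma shiftXn i : shift 'X^i = 'X^(i.+1).
Proof. by rewrite /shift map_polyXn exprS. Qed.

Lemma coef_shift q k : (shift q)`_k = if k is k'.+1 then a q`_k' else 0.
Proof. by rewrite /shift coefXM; case: k => //= k; rewrite coef_map. Qed.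

Lemma coef_iter_shift i q k :
  (iter i shift q)`_k = if (i <= k)%N then iter i a q`_(k - i) else 0.
Proof.
elim: i k => [|i IH] k /=; first by rewrite subn0.
by rewrite coef_shift; case: k => // k; rewrite IH ltnS subSS; case: ifP; rewrite ?rmorph0.
Qed.

Lemma sum_ord_widen (V : nmodType) (F : nat -> V) n m :
  (forall i, (n <= i)%N -> F i = 0) -> (forall i, (m <= i)%N -> F i = 0) ->
  \sum_(i < n) F i = \sum_(i < m) F i.
Proof.
suff H k l : (k <= l)%N -> (forall i, (k <= i)%N -> F i = 0) ->
    \sum_(i < k) F i = \sum_(i < l) F i.
  by move=> Fn Fm; case: (leqP n m) => [/H|/ltnW /H] ->.
move=> kl Fk; rewrite -!(big_mkord xpredT F) [RHS](big_cat_nat _ (n := k)) //=.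
rewrite [X in _ + X]big_nat_cond [X in _ + X]big1 ?addr0 // => i.
by rewrite andbT => /andP[/Fk].
Qed.

(** Left multiplication by [p] becomes a polynomial in the operator [shift]; associativity reduces
    to the compatibility of [shift] with right multiplication. *)
Lemma skew_mulE p q n : (size p <= n)%N ->
  skew_mul a p q = \sum_(i < n) p`_i *: iter i shift q.
Proof.
move=> szp; apply/polyP => k; rewrite coef_sum coef_poly.
pose F i := p`_i * (if (i <= k)%N then iter i a q`_(k - i) else 0).
have F0 i : (size p <= i)%N -> F i = 0 by move=> le; rewrite /F nth_default ?mul0r.
have -> : \sum_(i < n) (p`_i *: iter i shift q)`_k = \sum_(i < n) F i.
  by apply: eq_bigr => i _; rewrite coefZ coef_iter_shift.
have iter0 i : iter i a 0 = 0 by elim: i => //= i ->; rewrite rmorph0.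
have E : \sum_(i < n) F i = \sum_(i < k.+1) F i.
  apply: sum_ord_widen => i le; first by apply: F0; apply: leq_trans le.
  by rewrite /F leqNgt le mulr0.
rewrite E; case: ltnP => [_|le]; first by apply: eq_bigr => i _; rewrite /F -ltnS ltn_ord.
rewrite big1 // => i _; rewrite /F -ltnS ltn_ord.
case: (leqP (size p) i) => [szi|ltip]; first by rewrite nth_default ?mul0r.
rewrite [q`__]nth_default ?iter0 ?mulr0 //.
have ik : (i <= k)%N by rewrite -ltnS.
have lt : (i + size q < size p + size q)%N by rewrite ltn_add2r.
by rewrite leq_subRL //; apply: leq_trans le; rewrite -ltnS (ltn_predK lt).
Qed.

Lemma skew_mulDl p q r : skew_mul a (p + q) r = skew_mul a p r + skew_mul a q r.
Proof.
have [lp lq] := (leq_maxl (size p) (size q), leq_maxr (size p) (size q)).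
rewrite (skew_mulE _ lp) (skew_mulE _ lq) (skew_mulE _ (size_polyD p q)) -big_split.
by apply: eq_bigr => i _; rewrite coefD scalerDl.
Qed.

Lemma skew_mulDr p q r : skew_mul a p (q + r) = skew_mul a p q + skew_mul a p r.
Proof.
rewrite !(skew_mulE _ (leqnn _)) -big_split; apply: eq_bigr => i _.
by rewrite shift_iterD scalerDr.
Qed.

Lemma skew_mul0 r : skew_mul a 0 r = 0.
Proof. by rewrite (skew_mulE _ (leqnn _)) size_poly0 big_ord0. Qed.

Lemma skew_mulZl b p r : skew_mul a (b *: p) r = b *: skew_mul a p r.
Proof.
rewrite (skew_mulE _ (size_scale_leq b p)) (skew_mulE _ (leqnn _)) scaler_sumr.
by apply: eq_bigr => i _; rewrite coefZ scalerA.
Qed.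

Lemma skew_mul_shift p r : skew_mul a (shift p) r = shift (skew_mul a p r).
Proof.
have sz : (size (shift p) <= (size p).+1)%N.
  by apply/leq_sizeP => -[|j] lej; rewrite coef_shift // nth_default ?rmorph0.
rewrite (skew_mulE _ sz) (skew_mulE _ (leqnn _)) big_ord_recl coef_shift scale0r add0r.
rewrite (big_morph shift shiftD shift0); apply: eq_bigr => i _.
by rewrite shiftZ coef_shift.
Qed.

Lemma skew_mulA : associative (skew_mul a).
Proof.
move=> p q r; rewrite (skew_mulE q (leqnn (size p))) (skew_mulE _ (leqnn (size p))).
rewrite (big_morph (fun s => skew_mul a s r) (id1 := 0) (op1 := +%R)) //.
- apply: eq_bigr => i _; rewrite skew_mulZl; congr (_ *: _).
  by elim: (nat_of_ord i) => //= j ->; rewrite skew_mul_shift.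
- by move=> s t; apply: skew_mulDl.
exact: skew_mul0.
Qed.

Lemma skew_mulC b q : skew_mul a b%:P q = b *: q.
Proof. by rewrite (skew_mulE _ (size_polyC_leq1 b)) big_ord_recl big_ord0 addr0 coefC. Qed.

Lemma skew_mulX q : skew_mul a 'X q = shift q.
Proof.
rewrite (@skew_mulE _ _ 2) ?size_polyX // !big_ord_recl big_ord0 !coefX /=.
by rewrite scale0r add0r addr0 scale1r.
Qed.

Lemma skew_mul1 : left_id 1 (skew_mul a).
Proof. by move=> q; rewrite -[1]/(1%:P) skew_mulC scale1r. Qed.

Lemma skew_mulr1 : right_id 1 (skew_mul a).
Proof.
move=> p; rewrite (skew_mulE _ (leqnn _)) -[RHS]coefK poly_def.
apply: eq_bigr => i _; congr (_ *: _).
by elim: (nat_of_ord i) => [|j IH]; rewrite ?expr0 //= IH shiftXn.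
Qed.

End SkewMul.

(** A copy of the type that carries the skew product, as [{poly R}] already has its commutative
    one. *)
Definition skewpoly (R : comNzRingType) (a : {rmorphism R -> R}) : Type := {poly R}.

HB.instance Definition _ (R : comNzRingType) (a : {rmorphism R -> R}) :=
  GRing.Zmodule.copy (skewpoly a) {poly R}.

HB.instance Definition _ (R : comNzRingType) (a : {rmorphism R -> R}) :=
  GRing.Zmodule_isNzRing.Build (skewpoly a) (@skew_mulA R a) (@skew_mul1 R a)
    (@skew_mulr1 R a) (fun p q r => skew_mulDl a p q r) (fun p q r => skew_mulDr a p q r)
    (oner_neq0 {poly R}).

Definition skewC (R : comNzRingType) (a : {rmorphism R -> R}) (b : R) : skewpoly a := b%:P.

Lemma skewC_zmod (R : comNzRingType) (a : {rmorphism R -> R}) : zmod_morphism (@skewC R a).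
Proof. by move=> b d; apply: (rmorphB (@polyC R)). Qed.

Lemma skewC_monoid (R : comNzRingType) (a : {rmorphism R -> R}) : monoid_morphism (@skewC R a).
Proof.
split=> // b d; rewrite -[RHS]/(skew_mul a b%:P d%:P) skew_mulC -mul_polyC.
exact: (rmorphM (@polyC R)).
Qed.

HB.instance Definition _ (R : comNzRingType) (a : {rmorphism R -> R}) :=
  GRing.isZmodMorphism.Build R (skewpoly a) (@skewC R a) (@skewC_zmod R a).
HB.instance Definition _ (R : comNzRingType) (a : {rmorphism R -> R}) :=
  GRing.isMonoidMorphism.Build R (skewpoly a) (@skewC R a) (@skewC_monoid R a).

Definition theta (R : comNzRingType) (a : {rmorphism R -> R}) : skewpoly a := 'X.

Lemma theta_exp (R : comNzRingType) (a : {rmorphism R -> R}) i :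
  theta a ^+ i = 'X^i :> {poly R}.
Proof.
elim: i => // i IH; rewrite exprS -[LHS]/(skew_mul a 'X (theta a ^+ i)) IH skew_mulX.
exact: shiftXn.
Qed.

Lemma skewpoly_coefs (R : comNzRingType) (a : {rmorphism R -> R}) (p : {poly R}) n :
  (size p <= n)%N -> p = \sum_(i < n) skewC a p`_i * theta a ^+ i :> skewpoly a.
Proof.
move=> szp; rewrite -[LHS](skew_mulr1 a) (skew_mulE _ _ szp).
rewrite [RHS](big_morph (fun x : skewpoly a => (x : {poly R})) (id1 := 0) (op1 := +%R)) //.
apply: eq_bigr => i _; rewrite -[RHS]/(skew_mul a _ _) skew_mulC theta_exp.
congr (_ *: _); elim: (nat_of_ord i) => [|j IH]; rewrite ?expr0 //= IH.
exact: shiftXn.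
Qed.

Lemma skewpoly_ext (R : comNzRingType) (a : {rmorphism R -> R}) (ai : R -> R) :
  noetherian_ring R -> cancel a ai -> cancel ai a ->
  skew_ext (@skewC R a) a ai (theta a).
Proof.
move=> noe aK aiK; split=> // [b|s|N sN inc].
- rewrite -[LHS]/(skew_mul a 'X b%:P) -[RHS]/(skew_mul a (a b)%:P 'X) skew_mulX skew_mulC.
  by rewrite /shift map_polyC -mul_polyC mulrC.
- by exists (size (s : {poly R})), (fun i => (s : {poly R})`_i); apply: skewpoly_coefs.
have [|n Hn] := noe N _ inc; last by exists n => m x nm _; apply: Hn.
by move=> n; have [N0 ND NM] := sN n; split=> // r x Nx; rewrite mulrC; apply: NM.
Qed.

Lemma fin_gen_span (R : comNzRingType) (a : {rmorphism R -> R}) (M : zmodType)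
    (act : M -> skewpoly a -> M) (gs : seq M) (ss : seq {poly R}) :
  span act (fun x => x = 0) gs (\sum_(i < size gs) act gs`_i ss`_i).
Proof.
elim: gs ss => [|g gs IH] ss /=; first by rewrite big_ord0.
exists ss`_0; rewrite big_ord_recl /= addrC addKr; have := IH (behead ss).
by congr span; apply: eq_bigr => i _; rewrite nth_behead.
Qed.

Theorem theorem3p4 (R : comNzRingType) (a : {rmorphism R -> R})
  (V : zmodType) (act : V -> {poly R} -> V) :
  noetherian_ring R -> bijective a ->
  is_right_module a act -> simple_module act ->
  (* (Q ∩ R) S ⊆ Q and (Q ∩ R) S <> Q, where Q = Ann_S(V) *)
  (forall p, ext_ideal a (fun c => ann act c%:P) p -> ann act p) ->
  (exists p, ann act p /\ ~ ext_ideal a (fun c => ann act c%:P) p) ->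
  (quotient_right_artinian a (ann act) /\ quotient_left_artinian a (ann act)) /\
  (forall (M : zmodType) (actM : M -> {poly R} -> M) (f : V -> M),
     is_right_module a actM ->
     injective f ->
     (forall v w, f (v + w) = f v + f w) ->
     (forall v s, f (act v s) = actM (f v) s) ->
     (* f(V) is essential in M *)
     (forall N, is_submodule actM N -> (exists x, N x /\ x <> 0) ->
        exists v, v <> 0 /\ N (f v)) ->
     fin_gen actM ->
     artinian_module actM).
Proof.
move=> noe [ai aK aiK] Vact [V0 Vs] _ [p [Qp np]].
have SE := skewpoly_ext noe aK aiK.
pose actS : V -> skewpoly a -> V := act.
have VactS : rmodule actS by [].
suff [rd ld ext] : [/\ right_dcc (fun s => forall v, actS v s = 0),
    left_dcc (fun s => forall v, actS v s = 0) &
    forall (M : zmodType) (actM : M -> skewpoly a -> M) (f : V -> M) gs, rmodule actM ->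
      (forall x, span actM (fun x => x = 0) gs x) -> essential_extension actS actM f ->
      module_dcc actM].
  split; first by split=> [N sN|N sN]; [apply: rd|apply: ld].
  move=> M actM f Mact fI fD fA fe [gs Mgs].
  apply: (ext M actM f gs) => // x.
  by have [ss ->] := Mgs x; apply: fin_gen_span.
case: (theta_dichotomy SE VactS Vs) => [Vth|[thI thS]].
  exact: (zero_case SE VactS Vs Vth).
apply: (invertible_case SE VactS V0 Vs thI thS).
exists (size p), (fun i => p`_i); split.
  by rewrite /pol -skewpoly_coefs.
(* If all coefficients of [p] were in [P], its expansion in the powers of [theta] would place [p] in
   the extended ideal. *)
apply: NNPP => H; apply: np.
exists [seq (p`_i, 'X^i) | i <- index_iota 0 (size p)]; split=> [x /mapP [i]|].
  rewrite mem_index_iota => /andP[_ ltip] -> /=; apply: NNPP => nP.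
  by apply: H; exists i.
rewrite big_map big_mkord.
rewrite -{1}[p]coefK poly_def; apply: eq_bigr => i _ /=.
by rewrite skew_mulC.
Qed.
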